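(* Consider the minibatch stochastic model-based method with Nesterov acceleration, with parameters $\theta_k\in(0,1]$ for $k=0$, $\theta_k\in(0,1)$ for $k\geq 1$, $\gamma_k>0$ and batch sizes $m_k\ge1$, and define $\Gamma_0=1$ and $\Gamma_k=(1-\theta_k)^{-1}\Gamma_{k-1}$ for $k>0$. Let $x\in\mathcal X$ and $\Delta_k=f(x^k)-f(x)$. (a) If for all $k\ge0$ $$\Gamma_k\gamma_k\theta_k\ge\Gamma_{k+1}\gamma_{k+1}\theta_{k+1}\qquad\text{and}\qquad \gamma_k\ge\tau\theta_k,$$ then $$\Gamma_{K}\,\mathbb{E}[\Delta_{K+1}]\le(1-\theta_{0})\Delta_{0}+\frac{\Gamma_{0}\gamma_{0}\theta_{0}}{2}\|x-z^{0}\|^{2}+\sum_{k=0}^{K}\frac{2L^{2}\Gamma_{k}\theta_{k}}{m_{k}\gamma_{k}}.$$ (b) If moreover $x=x^*$ is an optimal solution of $\min_{x\in\mathcal X} f(x)$, and $m_k=m$, $\theta_k=\frac{2}{k+2}$, $\gamma_k=\frac{\gamma}{k+1}$ with $\gamma=2\tau+\eta$, $\eta=\frac{2L}{\sqrt{3m}\,\tilde D}(K+2)^{3/2}$, where $\tilde D>0$ and $\tilde D\ge\|x^0-x^*\|$, then $$\mathbb{E}\big[f(x^{K+1})-f(x^{*})\big]\le\frac{2\tau\tilde D^{2}}{(K+1)(K+2)}+\frac{4\sqrt{2}\,L\tilde D}{\sqrt{3m(K+1)}}.$$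
   Context: Setting: $\mathcal X\subseteq\mathbb R^d$ is a nonempty closed convex set, $\xi$ is a random sample with distribution $\Xi$, and $f(x)=\mathbb E_{\xi\sim\Xi}[f(x,\xi)]$ is to be minimized over $\mathcal X$, with $f(\cdot,\xi)$ continuous and $f$ bounded below. $\|\cdot\|$ is the Euclidean norm. For each $x\in\mathcal X$ and $\xi$ a model function $f_x(\cdot,\xi)$ is given such that, for constants $\tau\ge 0$, $L>0$ and all $\xi\sim\Xi$: (i) for all $x\in\mathcal X$, $f_x(\cdot,\xi)$ is convex, and $-\frac{\tau}{2}\|x-y\|^2\le f_x(y,\xi)-f(y,\xi)\le 0$ for all $y\in\mathcal X$; (ii) $f_x(x,\xi)=f(x,\xi)$ for all $x\in\mathcal X$; (iii) $f_x(z,\xi)-f_x(y,\xi)\le L\|z-y\|$ for all $x,y,z\in\mathcal X$. Minibatch stochastic model-based method with Nesterov acceleration: start from $x^0=z^0\in\mathcal X$; for $k=0,1,\dots,K$ draw a fresh batch $B_k=\{\xi_{k,1},\dots,\xi_{k,m_k}\}$ of i.i.d. samples from $\Xi$ (independent of previous batches) and, with $f_{y}(x,B_k)=\frac{1}{m_k}\sum_{i=1}^{m_k} f_y(x,\xi_{k,i})$, set $$y^k=(1-\theta_k)x^k+\theta_k z^k,\quad z^{k+1}=\mathrm{argmin}_{x\in\mathcal X}\Big\{f_{y^k}(x,B_k)+\frac{\gamma_k}{2}\|x-z^k\|^2\Big\},\quad x^{k+1}=(1-\theta_k)x^k+\theta_kz^{k+1}.$$ *)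

(* Defs.v *)
From HB Require Import structures.
From mathcomp Require Import all_boot all_order all_algebra finmap.
From mathcomp Require Import all_classical all_reals all_analysis.
Import Order.TTheory GRing.Theory Num.Theory numFieldNormedType.Exports.

Set Implicit Arguments.
Unset Strict Implicit.
Unset Printing Implicit Defensive.

Local Open Scope classical_set_scope.
Local Open Scope ring_scope.

(* The library norm on 'rV[R]_d is the sup norm, hence this definition. *)
Definition enorm (R : realType) (d : nat) (v : 'rV[R]_d) : R :=
  Num.sqrt (\sum_i v 0 i ^+ 2).

Definition borel_rV (R : realType) (d : nat) :=
  g_sigma_algebraType (@open 'rV[R]_d).

Definition argmin (R : realType) (T : Type) (X : set T) (g : T -> R) : set T :=
  [set u | X u /\ forall v, X v -> g u <= g v].

Definition mutually_independent (R : realType) (dO dS : measure_display)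
    (Omega : measurableType dO) (P : probability Omega R)
    (S : measurableType dS) (I : choiceType) (D : set I)
    (Y : I -> Omega -> S) : Prop :=
  forall (J : {fset I}) (A : I -> set S),
    [set` J] `<=` D -> (forall i, i \in J -> measurable (A i)) ->
    P (\bigcap_(i in [set` J]) (Y i @^-1` A i)) =
    (\prod_(i <- J) fine (P (Y i @^-1` A i)))%:E.

(* xi k i is sample number i of batch B_k, for k <= K and i < m k; the values
   of xi outside this range are irrelevant. Independence is over all pairs
   (k, i), hence both within and between batches. *)
Definition iid_batches (R : realType) (dO dS : measure_display)
    (Omega : measurableType dO) (P : probability Omega R)
    (S : measurableType dS) (Xi : probability S R) (K : nat) (m : nat -> nat)
    (xi : nat -> nat -> {RV P >-> S}) : Prop :=
  (forall k i, (k <= K)%N -> (i < m k)%N ->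
     forall A, measurable A -> distribution P (xi k i) A = Xi A) /\
  mutually_independent P
    [set p : nat * nat | (p.1 <= K)%N /\ (p.2 < m p.1)%N]
    (fun p => xi p.1 p.2).

Definition objective (R : realType) (d : nat) (dS : measure_display)
    (S : measurableType dS) (Xi : probability S R)
    (F : 'rV[R]_d -> S -> R) (x : 'rV[R]_d) : R :=
  fine ('E_Xi[F x])%E.

(* F x s is f(x, s). Integrability makes the expectation f(x) finite. *)
Definition stochastic_objective (R : realType) (d : nat) (dS : measure_display)
    (S : measurableType dS) (Xi : probability S R) (X : set 'rV[R]_d)
    (F : 'rV[R]_d -> S -> R) : Prop :=
  [/\ forall s, {within X, continuous (fun x => F x s)},
      forall x, X x -> Xi.-integrable setT (fun s => (F x s)%:E) &
      exists c, forall x, X x -> c <= objective Xi F x].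

(* fm x y s is the model f_x(y, s) built at x. The last clause is joint Borel
   measurability, without which the iterates and the expectations of the method
   would not be well defined. *)
Definition model_family (R : realType) (d : nat) (dS : measure_display)
    (S : measurableType dS) (X : set 'rV[R]_d) (F : 'rV[R]_d -> S -> R)
    (fm : 'rV[R]_d -> 'rV[R]_d -> S -> R) (tau L : R) : Prop :=
  [/\ forall x s, X x ->
        convex_function (X : set (convex_lmodType _)) (fun y => fm x y s),
      forall x y s, X x -> X y ->
        - (tau / 2) * enorm (x - y) ^+ 2 <= fm x y s - F y s <= 0,
      forall x s, X x -> fm x x s = F x s,
      forall x y z s, X x -> X y -> X z ->
        fm x z s - fm x y s <= L * enorm (z - y) &
      measurable_fun
        (X `*` X `*` setT : set (borel_rV R d * borel_rV R d * S)%type)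
        (fun p => fm p.1.1 p.1.2 p.2)].

(* f_y(u, B) for the batch B = {b 0, ..., b (n - 1)}. *)
Definition batch_model (R : realType) (d : nat) (S : Type)
    (fm : 'rV[R]_d -> 'rV[R]_d -> S -> R) (n : nat) (b : nat -> S)
    (y u : 'rV[R]_d) : R :=
  n%:R^-1 * \sum_(i < n) fm y u (b i).

Definition accelerated_model_method (R : realType) (d : nat) (Omega S : Type)
    (X : set 'rV[R]_d) (fm : 'rV[R]_d -> 'rV[R]_d -> S -> R) (K : nat)
    (m : nat -> nat) (theta gamma : nat -> R) (xi : nat -> nat -> Omega -> S)
    (x0 z0 : 'rV[R]_d) (x y z : nat -> Omega -> 'rV[R]_d) : Prop :=
  (forall w, x 0%N w = x0 /\ z 0%N w = z0) /\
  (forall k w, (k <= K)%N ->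
    [/\ y k w = (1 - theta k) *: x k w + theta k *: z k w,
        argmin X (fun u => batch_model fm (m k) (fun i => xi k i w) (y k w) u +
                           gamma k / 2 * enorm (u - z k w) ^+ 2) (z k.+1 w) &
        x k.+1 w = (1 - theta k) *: x k w + theta k *: z k.+1 w]).

Fixpoint Gamma (R : realType) (theta : nat -> R) (k : nat) : R :=
  if k is k'.+1 then (1 - theta k)^-1 * Gamma theta k' else 1.

(* Main.v *)
(** The step producing [z^{k+1}] minimizes the batch model, so the three-point
inequality compares the batch model at [z^{k+1}] with the batch model at [u].
The difficulty is that [z^{k+1}] depends on the batch on which it is evaluated.
Replacing one sample of the batch by a fresh one [s] moves the minimizer by at
most [2 L / (m gamma)], hence changes the model by at most
[2 L^2 / (m gamma)]; conditionally on all the other samples, the model at the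
displaced minimizer, evaluated at [s] and averaged over [s], has the same mean
as the batch model term at [z^{k+1}]. Every step thus gives a pointwise descent
inequality with a centered noise term; the inequalities are multiplied by
[Gamma_k], telescoped pointwise, and integrated only once. All integrals are
finite because each step moves by at most [L / gamma_k], so the iterates stay in
a deterministic ball. Conditioning is Fubini's theorem on the product of
[Omega], with the sigma-algebra generated by all samples but one, and the sample
space; the minimizers are measurable by strong convexity. *)

Require Import Defs.
From HB Require Import structures.
From mathcomp Require Import all_boot all_order all_algebra finmap ring lra.
From mathcomp Require Import all_classical all_reals all_analysis measurable_realfun.
Import Order.TTheory GRing.Theory Num.Theory numFieldNormedType.Exports.

Set Implicit Arguments.
Unset Strict Implicit.
Unset Printing Implicit Defensive.

Local Open Scope classical_set_scope.
Local Open Scope ring_scope.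

(** * Euclidean norm and proximal steps *)

Section EuclideanNorm.
Context {R : realType} {d : nat}.
Implicit Types a b c v : 'rV[R]_d.

Lemma enorm_ge0 v : 0 <= enorm v.
Proof. exact: sqrtr_ge0. Qed.

Lemma sqr_enorm v : enorm v ^+ 2 = \sum_i v 0 i ^+ 2.
Proof. by rewrite sqr_sqrtr// sumr_ge0// => i _; exact: sqr_ge0. Qed.

Lemma sqr_enormZ (k : R) v : enorm (k *: v) ^+ 2 = k ^+ 2 * enorm v ^+ 2.
Proof.
by rewrite !sqr_enorm mulr_sumr; apply: eq_bigr => i _; rewrite mxE exprMn.
Qed.

Lemma enormBC a b : enorm (a - b) = enorm (b - a).
Proof.
by rewrite /enorm; congr Num.sqrt; apply: eq_bigr => i _; rewrite !mxE; ring.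
Qed.

Lemma enorm0 : enorm (0 : 'rV[R]_d) = 0.
Proof.
by rewrite /enorm big1 ?sqrtr0// => i _; rewrite mxE expr0n.
Qed.

(** The negative last term is the exact strong convexity of the squared norm; it produces the
    quadratic gain in [prox_three_point]. *)
Lemma sqr_enorm_conv (t : R) a b c :
  enorm ((1 - t) *: a + t *: b - c) ^+ 2 =
  (1 - t) * enorm (a - c) ^+ 2 + t * enorm (b - c) ^+ 2
  - t * (1 - t) * enorm (b - a) ^+ 2.
Proof.
rewrite !sqr_enorm !mulr_sumr -sumrN -!big_split; apply: eq_bigr => i _ /=.
by rewrite !mxE; ring.
Qed.

Lemma enorm_eq0 v : enorm v = 0 -> v = 0.
Proof.
move=> v0; have /eqP := sqr_enorm v; rewrite v0 expr0n eq_sym psumr_eq0.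
  move=> /allP v20; apply/rowP => i; rewrite mxE.
  by apply/eqP; rewrite -sqrf_eq0; apply: v20; rewrite mem_index_enum.
by move=> i _; exact: sqr_ge0.
Qed.

(** Together with [ler_enorm_norm] this links the sup norm, which carries the topology, to the
    Euclidean norm of the estimates. *)
Lemma ler_norm_enorm v : `|v| <= enorm v.
Proof.
rewrite {1}/Num.norm/= mx_normrE; apply/bigmax_leP; split=> [|[i j] _ /=].
  exact: enorm_ge0.
rewrite ord1 -sqrtr_sqr ler_sqrt; last by rewrite sumr_ge0// => k _; exact: sqr_ge0.
by rewrite (bigD1 j)//= lerDl sumr_ge0// => k _; exact: sqr_ge0.
Qed.

Lemma ler_coord_norm v i : `|v 0 i| <= `|v|.
Proof.
rewrite [leRHS]/Num.norm/= mx_normrE.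
exact: (le_bigmax _ (fun ij => `|v ij.1 ij.2|) (ord0, i)).
Qed.

Lemma ler_enorm_norm v : enorm v <= Num.sqrt d%:R * `|v|.
Proof.
rewrite -{1}(ger0_norm (normr_ge0 v)) -sqrtr_sqr -sqrtrM ?ler0n//.
rewrite /enorm ler_sqrt ?mulr_ge0 ?sqr_ge0//.
have -> : d%:R * `|v| ^+ 2 = \sum_(i < d) `|v| ^+ 2.
  by rewrite sumr_const card_ord mulr_natl.
apply: ler_sum => i _.
by rewrite -real_normK ?num_real// lerXn2r ?nnegrE ?normr_ge0// ler_coord_norm.
Qed.

End EuclideanNorm.

Lemma le_of_scaled {R : realFieldType} (a c : R) :
  (forall t, 0 < t <= 1 -> a * (1 - t) <= c) -> a <= c.
Proof.
move=> ac; have c0 : 0 <= c.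
  by have := ac 1; rewrite subrr mulr0 ltr01 lexx; apply.
rewrite leNgt; apply/negP => ca.
have a0 : 0 < a by lra.
(* This [t] turns the hypothesis into [(a + c) / 2 <= c], which contradicts [c < a]; it stands in
   for the limit [t -> 0]. *)
have /ac : 0 < (a - c) / (2 * a) <= 1.
  apply/andP; split; first by rewrite divr_gt0 ?subr_gt0// mulr_gt0.
  by rewrite ler_pdivrMr ?mulr_gt0//; lra.
rewrite mulrBr mulr1.
have -> : a * ((a - c) / (2 * a)) = (a - c) / 2 by field; rewrite gt_eqF.
lra.
Qed.

Section ConvexCombinations.
Context {R : realType} {d : nat} (X : set 'rV[R]_d).

Lemma convex_setP a b (t : R) : convex_set (X : set (convex_lmodType _)) ->
  0 <= t <= 1 -> X a -> X b -> X ((1 - t) *: a + t *: b).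
Proof.
move=> cX /andP[t0 t1] Xa Xb.
rewrite addrC.
exact: set_mem (cX b a (Itv01 t0 t1) (mem_set Xb) (mem_set Xa)).
Qed.

Lemma convex_functionP (h : 'rV[R]_d -> R) a b (t : R) :
  convex_function (X : set (convex_lmodType _)) h ->
  0 <= t <= 1 -> X a -> X b ->
  h ((1 - t) *: a + t *: b) <= (1 - t) * h a + t * h b.
Proof.
move=> ch /andP[t0 t1] Xa Xb.
rewrite addrC [leRHS]addrC.
exact: ch (Itv01 t0 t1) b a (mem_set Xb) (mem_set Xa).
Qed.

Lemma convex_function_mean n (h : 'I_n -> 'rV[R]_d -> R) :
  (forall i, convex_function (X : set (convex_lmodType _)) (h i)) ->
  convex_function (X : set (convex_lmodType _))
    (fun v => n%:R^-1 * \sum_(i < n) h i v).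
Proof.
move=> ch t a b Xa Xb.
apply: (@le_trans _ _ (n%:R^-1 * \sum_(i < n)
    (t%:num * h i a + (1 - t%:num) * h i b))).
  by apply: ler_wpM2l; rewrite ?invr_ge0// ler_sum// => i _; exact: ch.
by rewrite big_split/= -!mulr_sumr mulrDr !(mulrCA n%:R^-1).
Qed.

End ConvexCombinations.

(** * Proximal steps: three-point inequality, stability, existence *)

Section Prox.
Context {R : realType} {d : nat} (X : set 'rV[R]_d).
Hypothesis cX : convex_set (X : set (convex_lmodType _)).
Implicit Types (h : 'rV[R]_d -> R) (u v z : 'rV[R]_d).

Definition prox_objective h (g : R) z u := h u + g / 2 * enorm (u - z) ^+ 2.

(* Compare with the points of the segment from [zp] to [u] and let them tend to [zp]. *)
Lemma prox_three_point h g z zp u :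
  convex_function (X : set (convex_lmodType _)) h ->
  argmin X (prox_objective h g z) zp -> X u ->
  prox_objective h g z zp + g / 2 * enorm (u - zp) ^+ 2
    <= prox_objective h g z u.
Proof.
move=> ch [Xzp zpmin] Xu; rewrite /prox_objective in zpmin *.
set D := enorm (u - zp) ^+ 2.
pose A := g / 2 * D.
pose C := h u + g / 2 * enorm (u - z) ^+ 2 -
  (h zp + g / 2 * enorm (zp - z) ^+ 2).
have step (t : R) : 0 < t <= 1 -> A * (1 - t) <= C.
  move=> /andP[t0 t1]; have t01 : 0 <= t <= 1 by rewrite ltW.
  have := zpmin _ (convex_setP cX t01 Xzp Xu).
  have := convex_functionP ch t01 Xzp Xu.
  rewrite sqr_enorm_conv -/D => h1 h2.
  by rewrite -(ler_pM2l t0) /A /C; lra.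
by have := le_of_scaled step; rewrite /A /C; lra.
Qed.

(** The three-point inequality at [u = z], with [e = enorm (zp - z)], gives
    [g e^2 <= h z - h zp <= L e]. *)
Lemma prox_step h (g L : R) z zp : 0 < g -> 0 < L ->
  convex_function (X : set (convex_lmodType _)) h ->
  (forall a b, X a -> X b -> h a - h b <= L * enorm (a - b)) ->
  X z -> argmin X (prox_objective h g z) zp -> enorm (zp - z) <= L / g.
Proof.
move=> g0 L0 ch hL Xz zpmin.
have Xzp := zpmin.1.
have := prox_three_point ch zpmin Xz.
rewrite /prox_objective subrr enorm0 (enormBC z zp) => h1.
have h2 := hL z zp Xz Xzp; rewrite enormBC in h2.
rewrite ler_pdivlMr//.
have [->|e0] := eqVneq (enorm (zp - z)) 0; first by rewrite mul0r ltW.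
have e1 : 0 < enorm (zp - z) by rewrite lt_neqAle eq_sym e0 enorm_ge0.
rewrite -(ler_pM2l e1); move: h1; rewrite expr0n/=; nra.
Qed.

(** Each minimizer is inserted in the three-point inequality of the other. In the sum the distances
    to [z] cancel, and [g * enorm (zp' - zp) ^+ 2] is bounded by the variation of [h - h'] between
    the minimizers. *)
Lemma prox_stability h h' g c z zp zp' : 0 < g -> 0 <= c ->
  convex_function (X : set (convex_lmodType _)) h ->
  convex_function (X : set (convex_lmodType _)) h' ->
  argmin X (prox_objective h g z) zp -> argmin X (prox_objective h' g z) zp' ->
  (h zp' - h' zp') - (h zp - h' zp) <= c * enorm (zp' - zp) ->
  enorm (zp' - zp) <= c / g.
Proof.
move=> g0 c0 ch ch' m m' hc.
have := prox_three_point ch m m'.1; have := prox_three_point ch' m' m.1.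
rewrite /prox_objective (enormBC zp zp') => h1 h2.
rewrite ler_pdivlMr//.
have [->|e0] := eqVneq (enorm (zp' - zp)) 0; first by rewrite mul0r.
have e1 : 0 < enorm (zp' - zp) by rewrite lt_neqAle eq_sym e0 enorm_ge0.
rewrite -(ler_pM2l e1); nra.
Qed.

Lemma prox_unique h g z zp zp' : 0 < g ->
  convex_function (X : set (convex_lmodType _)) h ->
  argmin X (prox_objective h g z) zp -> argmin X (prox_objective h g z) zp' ->
  zp' = zp.
Proof.
move=> g0 ch m m'; apply/eqP; rewrite -subr_eq0; apply/eqP/enorm_eq0/eqP.
rewrite eq_le enorm_ge0 andbT -[leRHS](mul0r g^-1).
by apply: (prox_stability g0 (lexx 0) ch ch m m'); rewrite mul0r !subrr.
Qed.

Lemma lipschitz_within_continuous h (L : R) : 0 < L ->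
  (forall a b, X a -> X b -> h a - h b <= L * enorm (a - b)) ->
  {within X, continuous h}.
Proof.
move=> L0 hL; apply/subspace_continuousP => x Xx.
apply/cvgrPdist_le => /= e e0.
(* The [+ 1] keeps [k] positive when [d = 0]. *)
pose k : R := L * (Num.sqrt d%:R + 1).
have k0 : 0 < k by rewrite mulr_gt0// ltr_wpDl ?sqrtr_ge0.
rewrite near_withinE; near=> v => Xv.
have xv : `|x - v| <= e / k.
  by near: v; apply: (@cvgr_dist_le _ _ _ _ _ id x) => //; rewrite divr_gt0.
have kL : L * enorm (x - v) <= e.
  rewrite (@le_trans _ _ (k * `|x - v|))//; last first.
    by rewrite -ler_pdivlMl// mulrC.
  rewrite /k -mulrA ler_pM2l// (le_trans (ler_enorm_norm _))//.
  by rewrite ler_wpM2r// lerDl.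
have h1 := hL _ _ Xx Xv; have h2 := hL _ _ Xv Xx.
rewrite enormBC in h2.
by change (`|h x - h v| <= e); rewrite ler_norml; apply/andP; split; lra.
Unshelve. all: by end_near. Qed.

Lemma continuous_sqr_enormB z : continuous (fun u => enorm (u - z) ^+ 2).
Proof.
have -> : (fun u => enorm (u - z) ^+ 2) =
          (fun u => \sum_i (u 0 i - z 0 i) ^+ 2).
  by apply/funext => u; rewrite sqr_enorm; apply: eq_bigr => i _; rewrite !mxE.
apply: (@continuous_big R _ (fun x y => x + y) 0 xpredT).
  by move=> p; apply: (@cvgD _ R); [exact: cvg_fst|exact: cvg_snd].
move=> i _ x.
have c1 : {for x, continuous (fun u : 'rV[R]_d => u 0 i)}.
  exact: (@coord_continuous R 1 d 0 i).
have c2 : {for x, continuous (fun _ : 'rV[R]_d => z 0 i)}.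
  exact: cst_continuous.
have c12 := @continuousB R _ _ _ _ x c1 c2.
exact: (continuous_comp c12 (@exprn_continuous R 2 _)).
Qed.

Lemma prox_objective_continuous h (g L : R) z : 0 < L ->
  (forall a b, X a -> X b -> h a - h b <= L * enorm (a - b)) ->
  {within X, continuous (prox_objective h g z)}.
Proof.
move=> L0 hL x; rewrite /prox_objective; apply: (@cvgD _ R).
  exact: (lipschitz_within_continuous L0 hL).
apply: (@cvgM R); first exact: cvg_cst.
exact: (@continuous_subspaceT _ _ X _ (@continuous_sqr_enormB z)).
Qed.

Lemma prox_exists h (g L : R) z : 0 < g -> 0 < L -> closed X ->
  (forall a b, X a -> X b -> h a - h b <= L * enorm (a - b)) ->
  X z -> argmin X (prox_objective h g z) !=set0.
Proof.
move=> g0 L0 clX hL Xz.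
(* Beyond this radius the quadratic term exceeds [L * enorm (w - z)], the most by which [h] can drop
   below [h z]. A minimizer over the compact set [A] is therefore global. *)
pose r : R := 2 * L / g.
have r0 : 0 < r by rewrite divr_gt0// mulr_gt0.
pose A := X `&` closed_ball z r.
have Az : A z by split=> //; exact: closed_ballxx.
have cA : compact A.
  apply: bounded_closed_compact.
    exists (`|z| + r); split; first exact: num_real.
    move=> M rM y [_]; rewrite closed_ballE// /closed_ball_/= => zy.
    rewrite (le_trans _ (ltW rM))// -[y](subKr z) (le_trans (ler_normB _ _))//.
    by rewrite lerD2l.
  by apply: closedI => //; exact: closed_ball_closed.
have [|v /set_mem[Xv _] vmin] := EVT_min_rV (ex_intro _ z Az) cA (f := prox_objective h g z).
  have /(continuous_subspaceW (@subIsetl _ X (closed_ball z r))) :=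
    @prox_objective_continuous h g L z L0 hL.
  exact.
exists v; split=> // w Xw.
have [wr|wr] := leP `|w - z| r.
  apply: vmin; apply/mem_set; split=> //.
  by rewrite closed_ballE// /closed_ball_ /= -normrN opprB.
rewrite (le_trans (vmin _ (mem_set Az)))//.
have {}wr : r < enorm (w - z) by rewrite (lt_le_trans wr)// ler_norm_enorm.
have := hL _ _ Xz Xw.
rewrite /prox_objective subrr enorm0 expr0n mulr0 addr0 enormBC => zw.
have : L * enorm (w - z) <= g / 2 * enorm (w - z) ^+ 2.
  rewrite expr2 mulrA ler_wpM2r ?enorm_ge0//.
  move: (ltW wr); rewrite /r ler_pdivrMr//; lra.
lra.
Qed.

End Prox.

(** * Borel measurability in finite dimension *)

Section BorelMeasurability.
Context {R : realType} {d : nat}.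
Local Notation V := 'rV[R]_d.

Lemma ex_invS_lt (e : R) : 0 < e -> exists k : nat, k.+1%:R^-1 < e.
Proof. by move=> /ltr_add_invr[k]; rewrite add0r; exists k. Qed.

Lemma rV_rat_approx (v : V) (e : R) : 0 < e ->
  exists r : 'rV[rat]_d, `|v - map_mx ratr r| < e.
Proof.
move=> e0.
have /choice[r rP] : forall i, exists q : rat, `|v 0 i - ratr q| < e.
  move=> i; have /rat_in_itvoo[q] : v 0 i - e < v 0 i + e by lra.
  by rewrite in_itv/= => qP; exists q; rewrite distrC ltr_distl.
exists (\row_i r i).
rewrite [ltLHS]/Num.norm/= mx_normrE; apply/bigmax_ltP; split=> // -[i j] _ /=.
by rewrite !mxE ord1.
Qed.

(** Rational points may all miss [X]. For each rational centre and radius [1 / (k + 1)] a point of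
    [X] in that ball is chosen when there is one, and [x0] otherwise. *)
Lemma rV_countable_dense (X : set V) : X !=set0 ->
  exists q : nat -> V, (forall n, X (q n)) /\
    forall v (e : R), X v -> 0 < e -> exists n, `|v - q n| < e.
Proof.
move=> [x0 Xx0].
have /choice[s sP] : forall p : 'rV[rat]_d * nat, exists s : V,
    X s /\ ((exists2 w, X w & `|w - map_mx ratr p.1| < p.2.+1%:R^-1) ->
            `|s - map_mx ratr p.1| < p.2.+1%:R^-1).
  move=> p; have [[w Xw wp]|nw] := pselect
    (exists2 w, X w & `|w - map_mx ratr p.1 : V| < p.2.+1%:R^-1).
    by exists w.
  by exists x0.
exists (fun n => oapp s x0 (choice.unpickle n)); split.
  by move=> n; case: choice.unpickle => //= p; have [] := sP p.
move=> v e Xv e0.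
have [k ke] : exists k : nat, k.+1%:R^-1 < e / 2.
  by apply: ex_invS_lt; rewrite divr_gt0.
have [r rv] := rV_rat_approx v (e := k.+1%:R^-1) ltac:(by []).
exists (choice.pickle (r, k)); rewrite choice.pickleK/=.
have [Xs /(_ (ex_intro2 _ _ v Xv rv)) /= sr] := sP (r, k).
rewrite -(subrKA (map_mx ratr r)) (le_lt_trans (ler_normD _ _))//.
by rewrite (distrC _ (s _)) [e]splitr ltrD// (lt_trans _ ke).
Qed.

Lemma measurable_coord d' (T : measurableType d') (f : T -> V) i :
  measurable_fun setT (f : T -> borel_rV R d) ->
  measurable_fun setT (fun t => f t 0 i).
Proof.
move=> mf; apply: (@measurableT_comp _ _ _ _ (borel_rV R d) _
  (fun v : V => v 0 i)) => //.
apply: (measurability _ (measurable_realfun.RGenOpens.measurableE R)) => _ [B [a [b Bab]] <-].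
have {Bab}oB : open B by rewrite Bab; exact: interval_open.
rewrite setTI.
apply: sub_sigma_algebra.
by apply: open_comp => // v _; exact: (@coord_continuous R 1 d 0 i).
Qed.

(** An open set is a countable union of rational balls contained in it, and a ball of the sup norm
    is a finite intersection of conditions on single coordinates. *)
Lemma measurable_rV d' (T : measurableType d') (f : T -> V) :
  (forall i, measurable_fun setT (fun t => f t 0 i)) ->
  measurable_fun setT (f : T -> borel_rV R d).
Proof.
move=> mf; apply: (@measurability _ _ T (borel_rV R d) setT _ (@open V)) => // _ [U oU <-].
rewrite setTI.
pose good (p : 'rV[rat]_d * nat) : Prop :=
  forall w : V, `|w - map_mx ratr p.1| < p.2.+1%:R^-1 -> U w.
pose B (p : 'rV[rat]_d * nat) : set T :=
  [set t | good p /\ `|f t - map_mx ratr p.1| < p.2.+1%:R^-1].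
have -> : f @^-1` U = \bigcup_p B p.
  apply/seteqP; split=> t; last by case=> p _ [gp /gp].
  move=> /= Uft.
  have /nbhs_normP[e /= e0 eU] : nbhs (f t) U by apply: open_nbhs_nbhs; split.
  have [k ke] : exists k : nat, k.+1%:R^-1 < e / 2.
    by apply: ex_invS_lt; rewrite divr_gt0.
  have [r rv] := rV_rat_approx (f t) (e := k.+1%:R^-1) ltac:(by []).
  exists (r, k) => //; split=> // w /= wr; apply: eU => /=.
  rewrite -(subrKA (map_mx ratr r)) (le_lt_trans (ler_normD _ _))//.
  by rewrite (distrC _ w) [e]splitr ltrD// (lt_trans _ ke).
apply: countable_bigcupT_measurable; first exact: countableP.
move=> p; have [gp|ngp] := pselect (good p); last first.
  by rewrite (_ : B p = set0)// -subset0 => t [].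
have -> : B p = \bigcap_(i in [set: 'I_d])
    ((fun t => f t 0 i) @^-1`
      `](ratr (p.1 0 i) - p.2.+1%:R^-1), (ratr (p.1 0 i) + p.2.+1%:R^-1)[).
  apply/seteqP; split=> t /=.
    move=> [_ ft] i _ /=; rewrite in_itv/= -ltr_distl.
    apply: le_lt_trans ft; have := ler_coord_norm (f t - map_mx ratr p.1) i.
    by rewrite !mxE.
  move=> h; split=> //.
  rewrite [ltLHS]/Num.norm/= mx_normrE; apply/bigmax_ltP; split=> // -[i j] _ /=.
  by rewrite !mxE ord1; have := h j I; rewrite /= in_itv/= -ltr_distl.
apply: fin_bigcap_measurable => // i _.
by rewrite -[X in measurable X]setTI; exact: mf.
Qed.

Lemma measurable_scaleDscale d' (T : measurableType d') (f g : T -> V) (a b : R) :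
  measurable_fun setT (f : T -> borel_rV R d) ->
  measurable_fun setT (g : T -> borel_rV R d) ->
  measurable_fun setT ((fun t => a *: f t + b *: g t) : T -> borel_rV R d).
Proof.
move=> mf mg; apply: measurable_rV => i; under eq_fun do rewrite !mxE.
by apply: measurable_funD; apply: measurable_funM => //; exact: measurable_coord.
Qed.

Lemma measurable_sqr_enormB d' (T : measurableType d') (f : T -> V) u :
  measurable_fun setT (f : T -> borel_rV R d) ->
  measurable_fun setT (fun t => enorm (u - f t) ^+ 2).
Proof.
move=> mf; under eq_fun do rewrite sqr_enorm.
apply: measurable_sum => i; apply: measurable_funX.
under eq_fun do rewrite !mxE.
by apply: measurable_funB => //; exact: measurable_coord.
Qed.

Lemma closed_measurable_rV (X : set V) : closed X ->
  measurable (X : set (borel_rV R d)).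
Proof.
move=> cX; rewrite -[X]setCK; apply: measurableC.
by apply: sub_sigma_algebra; exact: closed_openC.
Qed.

(** The preimage of an open set under [h] is only relatively open in [X]; since [v] takes its values
    in [X], it can be replaced by an open set of the whole space. *)
Lemma within_continuous_measurable d' (T : measurableType d') (X : set V)
    (h : V -> R) (v : T -> V) :
  {within X, continuous h} -> (forall t, X (v t)) ->
  measurable_fun setT (v : T -> borel_rV R d) ->
  measurable_fun setT (h \o v).
Proof.
move=> ch Xv mv; apply: (measurability _ (measurable_realfun.RGenOpens.measurableE R)) => _ [B [a [b Bab]] <-].
have {Bab}oB : open B by rewrite Bab; exact: interval_open.
rewrite setTI.
have oBX : open (h @^-1` B : set (subspace X)).
  by move/continuousP : ch; exact.
have [U oU UX] := (@open_subspaceP _ _ _).1 oBX.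
have -> : (h \o v) @^-1` B = v @^-1` U.
  apply/seteqP; split=> t /= Bt.
    by have [] : (U `&` X) (v t) by rewrite UX; split.
  by have [] : (h @^-1` B `&` X) (v t) by rewrite -UX; split.
rewrite -[X in measurable X]setTI; apply: mv => //.
exact: sub_sigma_algebra.
Qed.

(* The minimizer lies in an open set iff some point of a countable dense subset
   is nearly optimal, by an amount which the growth condition turns into a ball
   contained in that open set. *)
Lemma measurable_minimizer d' (T : measurableType d') (X : set V)
    (phi : T -> V -> R) (v : T -> V) (c : R) :
  0 < c -> X !=set0 ->
  (forall u, X u -> measurable_fun setT (phi ^~ u)) ->
  (forall t, {within X, continuous (phi t)}) ->
  (forall t, X (v t)) ->
  (forall t u, X u -> phi t (v t) + c * enorm (u - v t) ^+ 2 <= phi t u) ->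
  measurable_fun setT (v : T -> borel_rV R d).
Proof.
move=> c0 /rV_countable_dense[q [Xq qd]] mphi cphi Xv vmin.
have approx t (e e' : R) : 0 < e -> 0 < e' ->
    exists n, `|v t - q n| < e /\ phi t (q n) < phi t (v t) + e'.
  move=> e0 e'0.
  have /(_ _ (Xv t)) := (subspace_continuousP _ _).1 (cphi t).
  move=> /cvgrPdist_lt/(_ _ e'0); rewrite near_withinE => /nbhs_normP[r /= r0 rP].
  have [|n] := qd (v t) (Num.min e r) (Xv t); first by rewrite lt_min e0.
  rewrite lt_min => /andP[ne nr]; exists n; split=> //.
  have : `|phi t (v t) - phi t (q n)| < e' by exact: (rP (q n) nr (Xq n)).
  by rewrite ltr_distlC => /andP[].
apply: (@measurability _ _ T (borel_rV R d) setT _ (@open V)) => // _ [U oU <-].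
rewrite setTI.
(* A pair [(n, k)] codes the candidate [q n] and the tolerance [1 / (k + 1)]. If [q n] is optimal up
   to this tolerance, growth places the minimizer in the region that [good] requires to lie in
   [U]. *)
pose good (p : nat * nat) : Prop :=
  forall w : V, c * enorm (w - q p.1) ^+ 2 <= p.2.+1%:R^-1 -> U w.
pose B (p : nat * nat) : set T := [set t | good p /\
  forall n, phi t (q p.1) <= phi t (q n) + p.2.+1%:R^-1].
have -> : v @^-1` U = \bigcup_p B p.
  apply/seteqP; split=> t; last first.
    case=> -[n k] _ [gp np]; apply: gp => /=; rewrite enormBC.
    have := vmin t _ (Xq n).
    suff : phi t (q n) <= phi t (v t) + k.+1%:R^-1.
      by move: (k.+1%:R^-1) => s; lra.
    apply/ler_addgt0Pr => e e0.
    have [n' [_ n'P]] := approx t 1 e ltr01 e0.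
    have /= := np n'; move: (k.+1%:R^-1) => s; lra.
  move=> /= Uvt.
  have /nbhs_normP[e /= e0 eU] : nbhs (v t) U by apply: open_nbhs_nbhs; split.
  have e20 : 0 < e / 2 by rewrite divr_gt0.
  have [k ke] : exists k : nat, k.+1%:R^-1 < c * (e / 2) ^+ 2.
    by apply: ex_invS_lt; rewrite mulr_gt0// exprn_gt0.
  have [n [vn nk]] := approx t (e / 2) k.+1%:R^-1 e20 ltac:(by []).
  exists (n, k) => //; split=> [w /= wn|n' /=]; last first.
    have := vmin t _ (Xq n'); have := sqr_ge0 (enorm (q n' - v t)).
    by move=> /(mulr_ge0 (ltW c0)); move: (k.+1%:R^-1) nk => s; lra.
  apply: eU => /=.
  rewrite -(subrKA (q n)) (le_lt_trans (ler_normD _ _))//.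
  have : `|q n - w| < e / 2; last by lra.
  rewrite distrC (le_lt_trans (ler_norm_enorm _))//.
  rewrite -(@ltr_pXn2r _ 2)// ?nnegrE ?enorm_ge0 ?(ltW e20)//.
  by rewrite -(ltr_pM2l c0) (le_lt_trans wn).
apply: countable_bigcupT_measurable; first exact: countableP.
move=> p; have [gp|ngp] := pselect (good p); last first.
  by rewrite (_ : B p = set0)// -subset0 => t [].
(* Near optimality is tested against the dense points only, which leaves a countable intersection of
   measurable events. *)
have -> : B p = \bigcap_n
    (fun t => phi t (q p.1) <= phi t (q n) + p.2.+1%:R^-1) @^-1` [set true].
  by apply/seteqP; split=> t; [move=> [_ h] n _; exact: h|
    move=> h; split=> // n; exact: (h n I)].
apply: bigcap_measurable => // n _.
rewrite -[X in measurable X]setTI; apply: measurable_fun_ler => //.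
  exact: mphi.
by apply: measurable_funD => //; exact: mphi.
Qed.

End BorelMeasurability.

(** * Integrating out one independent sample *)

Lemma integrable_comp_pushforward {R : realType} {d1 d2 : measure_display}
    {T1 : measurableType d1} {T2 : measurableType d2}
    (mu : {measure set T1 -> \bar R}) (phi : {mfun T1 >-> T2})
    (f : T2 -> \bar R) :
  (pushforward mu phi).-integrable setT f -> mu.-integrable setT (f \o phi).
Proof.
move=> /integrableP[mf fy]; apply/integrableP; split.
  exact: measurableT_comp.
rewrite ge0_integral_pushforward// in fy.
by apply: measurableT_comp.
Qed.

Section IndependentFubini.
Context {R : realType} {dO dT dS : measure_display} {Omega : measurableType dO}
  {T : measurableType dT} {S : measurableType dS}.
Context (P : probability Omega R) (Xi : probability S R).
Context (W : {mfun Omega >-> T}) (Y : {mfun Omega >-> S}).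
Hypothesis indep : forall A C, measurable A -> measurable C ->
  P (W @^-1` A `&` Y @^-1` C) = (P (W @^-1` A) * Xi C)%E.
Context (psi : T * S -> R).
Hypothesis mpsi : measurable_fun setT psi.
Hypothesis ipsi :
  P.-integrable setT (EFin \o (fun w => psi (W w, Y w))).
Hypothesis ipsi_section :
  forall t, Xi.-integrable setT (EFin \o (fun s => psi (t, s))).

Let WY w := (W w, Y w).

Let mWY : measurable_fun setT WY.
Proof. by apply: measurable_fun_pair. Qed.

HB.instance Definition _ := isMeasurableFun.Build _ _ _ _ WY mWY.

Let productE A : measurable A ->
  (distribution P W \x Xi)%E A = distribution P (WY : {mfun _ >-> _}) A.
Proof.
apply: product_measure_unique => B C mB mC.
exact: indep.
Qed.

Let product_integrable : (distribution P W \x Xi)%E.-integrable setT (EFin \o psi).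
Proof.
have mpsiE : measurable_fun setT (EFin \o psi) by exact/measurable_EFinP.
apply/integrableP; split=> //.
rewrite (eq_measure_integral (distribution P (WY : {mfun _ >-> _}))); last first.
  by move=> A mA _; exact: productE.
have /integrableP[_] : (pushforward P WY).-integrable setT (EFin \o psi).
  by apply: integrable_pushforward => //.
by [].
Qed.

(** By independence the joint law of [(W, Y)] is the product of the law of [W] and [Xi], since the
    two agree on rectangles. The iterated integral over this product is the left-hand side. *)
Lemma independent_fubini :
  P.-integrable setT (EFin \o (fun w => \int[Xi]_s psi (W w, s))) /\
  \int[P]_w (\int[Xi]_s psi (W w, s)) = \int[P]_w psi (W w, Y w).
Proof.
have FE t : fubini_F Xi (EFin \o psi) t = (\int[Xi]_s psi (t, s))%:E.
  by rewrite fineK//; exact: (integrable_fin_num measurableT (ipsi_section t)).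
pose F := EFin \o (fun t => \int[Xi]_s psi (t, s)).
have {}FE : fubini_F Xi (EFin \o psi) = F by apply/funext.
have iF : (pushforward P W).-integrable setT F.
  by rewrite -FE; exact: integrable_fubini_F product_integrable.
have mF : measurable_fun setT F by case/integrableP : iF.
have iFW : P.-integrable setT (F \o W) by exact: integrable_comp_pushforward.
split=> //; rewrite /Rintegral; congr fine.
transitivity (\int[(distribution P W \x Xi)%E]_z (EFin \o psi) z)%E.
  rewrite -(integral12_prod_meas1 product_integrable) FE.
  by rewrite (@integral_pushforward _ _ _ _ _ W _ P setT F).
rewrite (eq_measure_integral (distribution P (WY : {mfun _ >-> _}))); last first.
  by move=> A mA _; exact: productE.
rewrite (@integral_pushforward _ _ _ _ _ WY mWY P setT (EFin \o psi))//.
exact/measurable_EFinP.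
Qed.

End IndependentFubini.

(** * The sigma-algebra of all samples but one *)

Section IndependentSigmaAlgebra.
Context {R : realType} {dO dS : measure_display} {Omega : measurableType dO}
  (P : probability Omega R) {S : measurableType dS} {I : choiceType}
  (D : set I) (Y : I -> {mfun Omega >-> S}) (p : I).
Hypothesis Dp : D p.
Hypothesis indep : mutually_independent P D Y.

(** A pi-system generating the sigma-algebra of the samples with index in [D] other than [p]; an
    empty [J] yields the whole space. *)
Definition other_cylinders : set (set Omega) :=
  [set A | exists (J : {fset I}) (B : I -> set S),
     [/\ [set` J] `<=` D `\ p, forall i, i \in J -> measurable (B i) &
         A = \bigcap_(i in [set` J]) (Y i @^-1` B i)]].

Lemma other_cylinders_measurable : other_cylinders `<=` measurable.
Proof.
move=> A [J [B [_ mB ->]]]; apply: fin_bigcap_measurable => // i iJ.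
exact: measurable_funPTI (mB i iJ).
Qed.

Lemma other_cylindersT : other_cylinders setT.
Proof.
exists fset0, (fun=> setT); split=> //.
by rewrite set_fset0 bigcap_set0.
Qed.

Lemma other_cylinders_setI : setI_closed other_cylinders.
Proof.
move=> _ _ [J1 [B1 [JD1 mB1 ->]]] [J2 [B2 [JD2 mB2 ->]]].
exists (J1 `|` J2)%fset, (fun i => (if i \in J1 then B1 i else setT) `&`
  (if i \in J2 then B2 i else setT)); split.
- by move=> i /=; rewrite in_fsetU => /orP[/JD1|/JD2].
- by move=> i _; apply: measurableI; case: ifPn => // ?; [exact: mB1|exact: mB2].
- apply/seteqP; split=> w /=.
    by move=> [h1 h2] i _ /=; split; case: ifPn => // iJ; [exact: h1|exact: h2].
  move=> h; split=> i /= iJ.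
    have iJ12 : i \in (J1 `|` J2)%fset by rewrite in_fsetU iJ.
    by have [] := h i iJ12; rewrite iJ.
  have iJ12 : i \in (J1 `|` J2)%fset by rewrite in_fsetU iJ orbT.
  by have [] := h i iJ12; rewrite iJ.
Qed.

Lemma measurable_other i : D i -> i != p ->
  measurable_fun setT (Y i : g_sigma_algebraType other_cylinders -> S).
Proof.
move=> Di ip _ A mA; rewrite setTI; apply: sub_sigma_algebra.
exists [fset i]%fset, (fun=> A); split=> //.
  by move=> j /=; rewrite inE => /eqP ->; split=> //; exact/eqP.
by rewrite set_fset1 bigcap_set1.
Qed.

(** Both sides are finite measures in [A]: the restriction of [P] to the event of [Y p], and a
    multiple of [P]. They agree on the pi-system of cylinders, hence on the sigma-algebra it
    generates. *)
Lemma independent_other A C :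
  @measurable _ (g_sigma_algebraType other_cylinders) A -> measurable C ->
  P (A `&` Y p @^-1` C) = (P A * P (Y p @^-1` C))%E.
Proof.
move=> mA mC; have mE : measurable (Y p @^-1` C) by exact: measurable_funPTI.
pose r : {nonneg R} := NngNum (fine_ge0 (measure_ge0 P (Y p @^-1` C))).
suff : mrestr P mE A = mscale r P A.
  rewrite /mrestr /mscale/= => ->; rewrite muleC fineK//.
  exact: fin_num_measure.
apply: (g_sigma_algebra_measure_unique other_cylinders
  other_cylinders_measurable (fun=> setT)) => //.
- by move=> ?; exact: other_cylindersT.
- by rewrite bigcup_const.
- exact: other_cylinders_setI.
- move=> _ [J [B [JD mB ->]]]; rewrite /mrestr/= /mscale/=.
  have JD' : [set` J] `<=` D by move=> i /JD[].
  rewrite (indep JD' mB).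
  (* Adding [p] to the index set, with event [C], makes the intersection a cylinder to which mutual
     independence applies. *)
  pose B' i := if i == p then C else B i.
  have pJ : p \notin J by apply/negP => /JD[_]; exact.
  have B'E i : i \in J -> B' i = B i.
    by rewrite /B'; case: eqP => // ->; rewrite (negbTE pJ).
  rewrite -EFinM.
  transitivity (P (\bigcap_(i in [set` (p |` J)%fset]) (Y i @^-1` B' i))).
    congr (P _).
    apply/seteqP; split=> w /=.
      move=> [h Yp] i /=; rewrite in_fset1U => /orP[/eqP ->|iJ].
        by rewrite /B' eqxx.
      by rewrite B'E//; exact: h.
    move=> h; split.
      by move=> i iJ /=; rewrite -B'E//; apply: h; rewrite /= in_fset1U iJ orbT.
    by have := h p; rewrite /= in_fset1U eqxx /B' eqxx; exact.
  rewrite indep.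
  + rewrite big_fsetU1//= /B' eqxx; congr (_ * _)%:E.
    by apply: eq_big_seq => i iJ; rewrite -/(B' i) B'E.
  + by move=> i /=; rewrite in_fset1U => /orP[/eqP ->|/JD'].
  + move=> i; rewrite in_fset1U /B'; case: eqP => // _ /= iJ; exact: mB.
- move=> _; apply: (@le_lt_trans _ _ 1%E); last exact: ltry.
  by apply: probability_le1; exact: measurableI.
Qed.

End IndependentSigmaAlgebra.

(** * Stochastic models *)

Section Models.
Context {R : realType} {d : nat} {dS : measure_display} {S : measurableType dS}.
Context (X : set 'rV[R]_d) (F : 'rV[R]_d -> S -> R)
  (fm : 'rV[R]_d -> 'rV[R]_d -> S -> R) (tau L : R).
Local Notation V := 'rV[R]_d.
Hypothesis clX : closed X.
Hypothesis cX : convex_set (X : set (convex_lmodType _)).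
Hypothesis L_gt0 : 0 < L.
Hypothesis model : model_family X F fm tau L.
Implicit Types (a b u v : V) (s : S).

Lemma model_lipschitz a u v s : X a -> X u -> X v ->
  fm a u s - fm a v s <= L * enorm (u - v).
Proof. by move=> Xa Xu Xv; case: model => _ _ _ h _; exact: h. Qed.

Lemma model_le a u s : X a -> X u -> fm a u s <= F u s.
Proof.
by move=> Xa Xu; case: model => _ /(_ a u s Xa Xu)/andP[_ h] _ _ _; lra.
Qed.

Lemma model_ge a u s : X a -> X u ->
  F u s <= fm a u s + tau / 2 * enorm (a - u) ^+ 2.
Proof.
by move=> Xa Xu; case: model => _ /(_ a u s Xa Xu)/andP[h _] _ _ _; lra.
Qed.

Lemma model_diag a s : X a -> fm a a s = F a s.
Proof. by move=> Xa; case: model => _ _ h _ _; exact: h. Qed.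

(** The model built at [u] equals [F] at [u], lies below [F] at [v], and is Lipschitz in between. *)
Lemma sample_lipschitz u v s : X u -> X v -> F u s - F v s <= L * enorm (u - v).
Proof.
move=> Xu Xv; have := model_lipschitz s Xu Xu Xv.
by have := model_le s Xu Xv; rewrite model_diag//; lra.
Qed.

(** Supplies the integrable majorant for all model values at points of a ball around [c]. The [3]
    adds a distance of at most [2 * C] from [a] to [v] to one of at most [C] to the centre. *)
Lemma model_dist_bound a v c (C : R) s : X a -> X v -> X c ->
  `|a - c| <= C -> `|v - c| <= C ->
  `|fm a v s| <= `|F c s| + L * (Num.sqrt d%:R * (3 * C)).
Proof.
move=> Xa Xv Xc ac vc.
have E u w (B : R) : `|u - w| <= B -> L * enorm (u - w) <= L * (Num.sqrt d%:R * B).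
  move=> uwB; rewrite ler_wpM2l ?(ltW L_gt0)// (le_trans (ler_enorm_norm _))//.
  by rewrite ler_wpM2l ?sqrtr_ge0.
have C0 : 0 <= C by exact: le_trans ac.
have av : `|a - v| <= 2 * C.
  rewrite -(subrKA c) (le_trans (ler_normD _ _))// (distrC c v); lra.
have h1 := E _ _ _ vc; have h2 := E _ _ _ av.
have h3 := E c a C; rewrite distrC in h3; have {}h3 := h3 ac.
have := sample_lipschitz s Xv Xc; have := model_le s Xa Xv.
have := sample_lipschitz s Xc Xa; have := model_lipschitz s Xa Xa Xv.
rewrite model_diag//.
have : 0 <= L * (Num.sqrt d%:R * C) by rewrite !mulr_ge0 ?sqrtr_ge0// ltW.
have := ler_norm (F c s); have := ler_norm (- F c s); rewrite normrN => *.
 rewrite ler_norml; apply/andP; split; lra.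
Qed.

Section Batch.
Context (n : nat) (n_gt0 : (0 < n)%N).

Lemma batch_model_convex (b : nat -> S) a : X a ->
  convex_function (X : set (convex_lmodType _)) (batch_model fm n b a).
Proof.
move=> Xa; apply: convex_function_mean => i.
by case: model => + _ _ _ _; exact.
Qed.

Lemma batch_model_lipschitz (b : nat -> S) a u v : X a -> X u -> X v ->
  batch_model fm n b a u - batch_model fm n b a v <= L * enorm (u - v).
Proof.
move=> Xa Xu Xv; rewrite /batch_model -mulrBr -sumrB ler_pdivrMl ?ltr0n//.
rewrite mulr_natl -[X in _ *+ X]card_ord -sumr_const.
by apply: ler_sum => i _; exact: model_lipschitz.
Qed.

Lemma batch_model_swap (b b' : nat -> S) (i : 'I_n) a u :
  (forall j, j != i :> nat -> b j = b' j) ->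
  batch_model fm n b a u - batch_model fm n b' a u =
  n%:R^-1 * (fm a u (b i) - fm a u (b' i)).
Proof.
move=> bb'; rewrite /batch_model -mulrBr -sumrB; congr (_ * _).
rewrite (bigD1 i)//= big1 ?addr0// => j ji.
by rewrite bb' ?subrr.
Qed.

(** The two batch models differ by [n^-1] times the difference of two [L]-Lipschitz functions, so
    [prox_stability] applies with [c = 2 L / n]. *)
Lemma batch_prox_stability (b b' : nat -> S) (i : 'I_n) (g : R) a z zp zp' :
  0 < g -> X a -> (forall j, j != i :> nat -> b j = b' j) ->
  argmin X (prox_objective (batch_model fm n b a) g z) zp ->
  argmin X (prox_objective (batch_model fm n b' a) g z) zp' ->
  enorm (zp' - zp) <= 2 * L / (n%:R * g).
Proof.
move=> g0 Xa bb' m m'; have Xzp := m.1; have Xzp' := m'.1.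
have n0 : (0 : R) < n%:R by rewrite ltr0n.
rewrite [leRHS](_ : _ = n%:R^-1 * (2 * L) / g); last first.
  by rewrite invfM; ring.
apply: (prox_stability cX g0 _ (batch_model_convex b Xa)
  (batch_model_convex b' Xa) m m').
  by rewrite !mulr_ge0// ?invr_ge0 ltW.
rewrite !(batch_model_swap _ _ bb') -mulrBr -!mulrA ler_pM2l ?invr_gt0//.
have := model_lipschitz (b i) Xa Xzp' Xzp.
have := model_lipschitz (b' i) Xa Xzp Xzp'.
rewrite (enormBC zp zp'); lra.
Qed.

End Batch.

Section Measurability.
Context {dT : measure_display} {T : measurableType dT}.
Local Notation measurableV f := (measurable_fun setT (f : T -> borel_rV R d)).

Lemma measurable_model (f g : T -> V) (h : T -> S) :
  measurableV f -> measurableV g -> measurable_fun setT h ->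
  (forall t, X (f t)) -> (forall t, X (g t)) ->
  measurable_fun setT (fun t => fm (f t) (g t) (h t)).
Proof.
move=> mf mg mh Xf Xg; case: model => _ _ _ _ mfm.
pose D : set (borel_rV R d * borel_rV R d * S) := X `*` X `*` setT.
apply: (measurable_comp (F := D)
  (f := fun p : borel_rV R d * borel_rV R d * S => fm p.1.1 p.1.2 p.2)
  (g := fun t => (f t, g t, h t))) => //.
- by apply: measurableX => //; apply: measurableX; exact: closed_measurable_rV.
- by move=> _ [t _ <-]; split=> //; split; [exact: Xf|exact: Xg].
- by apply: measurable_fun_pair => //; exact: measurable_fun_pair.
Qed.

Lemma measurable_prox n (g : R) (b : nat -> T -> S) (f z v : T -> V) :
  (0 < n)%N -> 0 < g ->
  (forall i, (i < n)%N -> measurable_fun setT (b i)) ->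
  measurableV f -> measurableV z ->
  (forall t, X (f t)) -> (forall t, X (z t)) ->
  (forall t, argmin X
    (prox_objective (batch_model fm n (fun i => b i t) (f t)) g (z t)) (v t)) ->
  measurableV v.
Proof.
move=> n0 g0 mb mf mz Xf Xz vmin.
have Xv t : X (v t) := (vmin t).1.
(* On an empty [T] every map is measurable; otherwise [f t0] shows that [X] is nonempty. *)
have [[t0 _]|T0] := pselect (exists _ : T, True); last first.
  by move=> _ A mA; rewrite (_ : _ `&` _ = set0)// -subset0 => t; case: T0; exists t.
pose phi t := prox_objective (batch_model fm n (fun i => b i t) (f t)) g (z t).
apply: (@measurable_minimizer R d _ T X phi v (g / 2)) => //.
- by rewrite divr_gt0.
- by exists (f t0).
- move=> u Xu; apply: measurable_funD.
    apply: measurable_funM => //; apply: measurable_sum => i.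
    by apply: measurable_model => //; exact: mb.
  by apply: measurable_funM => //; exact: measurable_sqr_enormB.
- move=> t; apply: prox_objective_continuous L_gt0 _ => u w Xu Xw.
  exact: batch_model_lipschitz.
- by move=> t u Xu; apply: (prox_three_point cX) => //; exact: batch_model_convex.
Qed.

End Measurability.

End Models.

(** * Weights and rates *)

Section Weights.
Context {R : realType} (theta : nat -> R).
Hypothesis theta_lt1 : forall k, (0 < k)%N -> theta k < 1.

Lemma Gamma_gt0 k : 0 < Gamma theta k.
Proof.
elim: k => [|k IH] /=; first exact: ltr01.
by rewrite mulr_gt0// invr_gt0 subr_gt0 theta_lt1.
Qed.

Lemma GammaS k : Gamma theta k.+1 * (1 - theta k.+1) = Gamma theta k.
Proof. by rewrite /= mulrC mulVKf// subr_eq0 gt_eqF// theta_lt1. Qed.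

(** [D] is the gap, [V] the squared distance, [c] the deterministic error and [N] the noise. After
    multiplication by [Gamma], the identity [GammaS] telescopes the gaps, monotonicity of the
    weights telescopes the distances, and the last distance is dropped. *)
Lemma weighted_telescope (gamma D V c N : nat -> R) (K : nat) :
  (forall k, 0 <= V k) ->
  (forall k, (k < K)%N -> Gamma theta k.+1 * gamma k.+1 * theta k.+1
     <= Gamma theta k * gamma k * theta k) ->
  0 <= Gamma theta K * gamma K * theta K ->
  (forall k, (k <= K)%N -> D k.+1 + theta k * gamma k / 2 * V k.+1 <=
     (1 - theta k) * D k + theta k * gamma k / 2 * V k + c k + N k) ->
  Gamma theta K * D K.+1 <=
    (1 - theta 0%N) * D 0%N + Gamma theta 0 * gamma 0%N * theta 0%N / 2 * V 0%N
    + \sum_(k < K.+1) Gamma theta k * c k + \sum_(k < K.+1) Gamma theta k * N k.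
Proof.
move=> V0 + + step.
have := GammaS; have := Gamma_gt0; have : Gamma theta 0 = 1 by [].
move: (Gamma theta) => G G0 G_gt0 GS mono last0.
set B := (X in _ <= X + _ + _).
have tel n : (n <= K)%N -> G n * D n.+1 + G n * gamma n * theta n / 2 * V n.+1 <=
    B + \sum_(k < n.+1) G k * c k + \sum_(k < n.+1) G k * N k.
  elim: n => [_|n IH nK].
    rewrite !big_ord_recl !big_ord0 /B /= G0 !mul1r !addr0.
    by have := step 0%N (leq0n _); lra.
  have {}IH := IH (ltnW nK).
  rewrite [X in _ + X + _]big_ord_recr [X in _ <= _ + X]big_ord_recr /=.
  have := ler_wpM2l (ltW (G_gt0 n.+1)) (step n.+1 nK).
  have := ler_wpM2r (V0 n.+1) (mono n nK).
  have -> : G n.+1 * ((1 - theta n.+1) * D n.+1 +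
      theta n.+1 * gamma n.+1 / 2 * V n.+1 + c n.+1 + N n.+1) =
    G n * D n.+1 + G n.+1 * gamma n.+1 * theta n.+1 / 2 * V n.+1
    + G n.+1 * c n.+1 + G n.+1 * N n.+1.
    by rewrite -(GS n); ring.
  lra.
have := tel K (leqnn K).
have := mulr_ge0 last0 (V0 K.+1); lra.
Qed.

End Weights.

Section QuadraticWeights.
Context {R : realType} (theta : nat -> R).
Hypothesis thetaE : forall k, theta k = 2 / (k + 2)%:R.

Lemma GammaE k : Gamma theta k = (k + 1)%:R * (k + 2)%:R / 2.
Proof.
elim: k => [|k IH]; first by rewrite /= !add0n mul1r divff.
rewrite /= IH thetaE !natrD !mulrSr/=.
have k0 : (0 : R) <= k%:R by [].
field; apply/andP; split; rewrite gt_eqF//; lra.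
Qed.

End QuadraticWeights.

(** With [t = n + 2] the induction step reads [t^3 / 3 + t^2 <= (t + 1)^3 / 3]. The cube of [n + 2]
    matches the power [3 / 2] of [K + 2] in [eta]. *)
Lemma sum_sqr_le {R : realType} (n : nat) :
  \sum_(k < n.+1) ((k + 1)%:R : R) ^+ 2 <= (n + 2)%:R ^+ 3 / 3.
Proof.
elim: n => [|n IH].
  by rewrite big_ord_recl big_ord0 /=; lra.
rewrite big_ord_recr/=; apply: (le_trans (lerD IH (lexx _))).
have -> : (n.+1 + 2)%:R = (n + 2)%:R + 1 :> R by rewrite addSn -natr1.
have -> : (n.+1 + 1)%:R = (n + 2)%:R :> R by rewrite addSn -addnS.
have : (0 : R) <= (n + 2)%:R by [].
move: (n + 2)%:R => t; lra.
Qed.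

(* The choice of [eta] balances the two terms [eta D^2 / 2] and
   [2 L^2 p^3 / (3 m eta)]. *)
Lemma balanced_step_bound {R : realType} (tau L D mb p eta : R) (n : nat) :
  0 <= tau -> 0 < L -> 0 < D -> 0 < mb -> p = (n + 2)%:R ->
  eta = 2 * L / (Num.sqrt (3 * mb) * D) * p `^ (3 / 2) ->
  (2 * tau + eta) / 2 * D ^+ 2 + 2 * L ^+ 2 / (mb * (2 * tau + eta)) * (p ^+ 3 / 3)
  <= (n + 1)%:R * p / 2 *
     (2 * tau * D ^+ 2 / ((n + 1)%:R * p)
      + 4 * Num.sqrt 2 * L * D / Num.sqrt (3 * mb * (n + 1)%:R)).
Proof.
move=> tau0 L0 D0 mb0 pE etaE0.
have p0 : 0 < p by rewrite pE ltr0n addn2.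
have n1 : (0 : R) < (n + 1)%:R by rewrite ltr0n addn1.
set r := Num.sqrt p; set s := Num.sqrt (3 * mb).
have r0 : 0 < r by rewrite sqrtr_gt0.
have s0 : 0 < s by rewrite sqrtr_gt0 mulr_gt0.
have rr : r * r = p by rewrite -expr2 sqr_sqrtr// ltW.
have ss : s * s = 3 * mb by rewrite -expr2 sqr_sqrtr// mulr_ge0// ltW.
have pq : p `^ (3 / 2) = p * r.
  have -> : (3 / 2 : R) = 1 + 2^-1 by lra.
  by rewrite powRD ?gt_eqF ?implybT// powRr1 ?ltW// powR12_sqrt// ltW.
have etaE : eta = 2 * L / (s * D) * (p * r) by rewrite etaE0 pq.
have eta0 : 0 < eta by rewrite etaE; apply: mulr_gt0; [apply: divr_gt0|]; apply: mulr_gt0.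
have h1 : eta / 2 * D ^+ 2 = L * D * p * r / s.
  by rewrite etaE; field; rewrite !gt_eqF.
(* Dropping [2 * tau] from the denominator only increases the term; what remains equals
   [eta / 2 * D ^+ 2] exactly. *)
have h2 : 2 * L ^+ 2 / (mb * (2 * tau + eta)) * (p ^+ 3 / 3) <= L * D * p * r / s.
  have -> : L * D * p * r / s = 2 * L ^+ 2 / (mb * eta) * (p ^+ 3 / 3).
    have mbE : mb = s * s / 3 by rewrite ss; field.
    by rewrite etaE mbE -rr; field; rewrite !gt_eqF.
  rewrite ler_wpM2r ?divr_ge0 ?exprn_ge0 ?(ltW p0)//.
  rewrite ler_wpM2l ?mulr_ge0 ?exprn_ge0 ?(ltW L0)//.
  rewrite lef_pV2 ?posrE ?mulr_gt0//; last by rewrite ltr_wpDl// mulr_ge0.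
  by rewrite ler_pM2l// lerDr mulr_ge0.
set q := Num.sqrt ((n + 1)%:R : R).
have q0 : 0 < q by rewrite sqrtr_gt0.
have qq : q * q = (n + 1)%:R by rewrite -expr2 sqr_sqrtr// ltW.
have -> : Num.sqrt (3 * mb * (n + 1)%:R) = s * q.
  by rewrite sqrtrM// mulr_ge0// ltW.
(* The factor [sqrt 2] of the rate comes from [n + 2 <= 2 (n + 1)]. *)
have rq : r <= Num.sqrt 2 * q.
  have p2 : p <= 2 * (n + 1)%:R.
    by rewrite pE -natrM ler_nat mulnDr muln1 leq_add2r leq_pmull.
  by rewrite -(sqrtrM _ (ler0n R 2)); apply: ler_wsqrtr.
have -> : (n + 1)%:R * p / 2 * (2 * tau * D ^+ 2 / ((n + 1)%:R * p)
      + 4 * Num.sqrt 2 * L * D / (s * q)) =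
    tau * D ^+ 2 + 2 * (L * D * p / s) * (Num.sqrt 2 * q).
  by rewrite -qq; field; rewrite !gt_eqF.
have h3 : 2 * (L * D * p / s) * r <= 2 * (L * D * p / s) * (Num.sqrt 2 * q).
  by rewrite ler_wpM2l// ltW// mulr_gt0// divr_gt0// !mulr_gt0.
have -> : (2 * tau + eta) / 2 * D ^+ 2 = tau * D ^+ 2 + eta / 2 * D ^+ 2.
  by field.
rewrite h1.
have e : L * D * p * r / s = L * D * p / s * r by ring.
rewrite e in h2 *; lra.
Qed.

(** * Real-valued expectations and centered noise *)

Section RealExpectation.
Context {R : realType} {d : measure_display} {T : measurableType d}
  (P : probability T R).
Implicit Types f g h : T -> R.

Lemma probability_integrable_cst (c : R) : P.-integrable setT (EFin \o cst c).
Proof. exact: finite_measure_integrable_cst. Qed.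

Lemma Rintegral_probability_cst (c : R) : \int[P]_w cst c w = c.
Proof.
rewrite Rintegral_cst//=.
by rewrite [X in fine X](_ : _ = 1%E) ?mulr1//; exact: probability_setT.
Qed.

Lemma integrable_lincomb f g (a b : R) :
  P.-integrable setT (EFin \o f) -> P.-integrable setT (EFin \o g) ->
  P.-integrable setT (EFin \o (fun w => a * f w + b * g w)).
Proof.
move=> fi gi.
rewrite (_ : _ \o _ = fun w => (a%:E * (f w)%:E + b%:E * (g w)%:E)%E)//.
by apply: integrableD => //; apply: integrableZl.
Qed.

Lemma Rintegral_lincomb f g (a b : R) :
  P.-integrable setT (EFin \o f) -> P.-integrable setT (EFin \o g) ->
  \int[P]_w (a * f w + b * g w) = a * \int[P]_w f w + b * \int[P]_w g w.
Proof.
move=> fi gi.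
have afi : P.-integrable setT (EFin \o (fun w => a * f w)).
  rewrite (_ : _ \o _ = fun w => (a%:E * (f w)%:E)%E)//; exact: integrableZl.
have bgi : P.-integrable setT (EFin \o (fun w => b * g w)).
  rewrite (_ : _ \o _ = fun w => (b%:E * (g w)%:E)%E)//; exact: integrableZl.
by rewrite RintegralD// !RintegralZl.
Qed.

Lemma le_Rintegral_affine f g h (a b c : R) :
  P.-integrable setT (EFin \o h) ->
  P.-integrable setT (EFin \o f) -> P.-integrable setT (EFin \o g) ->
  (forall w, h w <= a * f w + b * g w + c) ->
  \int[P]_w h w <= a * \int[P]_w f w + b * \int[P]_w g w + c.
Proof.
move=> hi fi gi hfg.
have fgi := integrable_lincomb a b fi gi.
have ci := probability_integrable_cst c.
rewrite -(Rintegral_lincomb a b fi gi) -[X in _ + X]Rintegral_probability_cst.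
rewrite -RintegralD//; apply: le_Rintegral => //.
rewrite (_ : _ \o _ = (EFin \o (fun w => a * f w + b * g w)%R) \+
  (EFin \o cst c))%E//.
exact: integrableD.
Qed.

Lemma dominated_integrable f g (c : R) : measurable_fun setT f ->
  P.-integrable setT (EFin \o g) -> (forall t, `|f t| <= `|g t| + c) ->
  P.-integrable setT (EFin \o f).
Proof.
move=> mf gi fg.
have gci : P.-integrable setT (EFin \o (fun w => 1 * `|g w| + 1 * cst c w)).
  apply: integrable_lincomb; last exact: probability_integrable_cst.
  have := integrable_abse gi; exact.
apply: (le_integrable _ _ _ gci) => //; first exact/measurable_EFinP.
move=> t _ /=; rewrite lee_fin !mul1r (le_trans (fg t))//.
exact: ler_norm.
Qed.

(** Integrability is part of the notion because the real-valued integral also reads 0 when the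
    extended one is infinite. *)
Definition centered f := P.-integrable setT (EFin \o f) /\ \int[P]_w f w = 0.

Lemma centered_lincomb f g (a b : R) : centered f -> centered g ->
  centered (fun w => a * f w + b * g w).
Proof.
move=> [fi f0] [gi g0]; split; first exact: integrable_lincomb.
by rewrite Rintegral_lincomb// f0 g0 !mulr0 addr0.
Qed.

Lemma centered_sum n (c : 'I_n -> R) (f : 'I_n -> T -> R) :
  (forall i, centered (f i)) -> centered (fun w => \sum_(i < n) c i * f i w).
Proof.
elim: n c f => [|n IH] c f fc.
  under eq_fun do rewrite big_ord0.
  split; first exact: (probability_integrable_cst 0).
  exact: (Rintegral_probability_cst 0).
under eq_fun do rewrite big_ord_recl.
have := centered_lincomb (c ord0) 1 (fc ord0)
  (IH (fun i => c (lift ord0 i)) _ (fun i => fc (lift ord0 i))).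
by under eq_fun do rewrite mul1r.
Qed.

Lemma expectation_le_centered f g (a c : R) : 0 < a ->
  P.-integrable setT (EFin \o f) -> centered g ->
  (forall w, a * f w <= c + g w) ->
  (a%:E * 'E_P[f] <= c%:E)%E.
Proof.
move=> a0 fi [gi g0] fg.
rewrite unlock -[X in (_ * X)%E]fineK; last exact: (integrable_fin_num measurableT fi).
rewrite -EFinM lee_fin.
rewrite -RintegralZl//.
(* The bound takes two functions; [g] fills both places, the second with weight 0. *)
have := le_Rintegral_affine (h := fun w => a * f w) _ gi gi (a := 1) (b := 0) (c := c).
rewrite g0 mul0r mulr0 !add0r; apply.
  have := integrable_lincomb a 0 fi fi.
  by under eq_fun do rewrite mul0r addr0.
by move=> w; have := fg w; lra.
Qed.

End RealExpectation.

(** * The accelerated method *)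

Section Method.
Context {R : realType} {d : nat} {dO dS : measure_display}
  {Omega : measurableType dO} (P : probability Omega R) {S : measurableType dS}
  (Xi : probability S R) (X : set 'rV[R]_d) (F : 'rV[R]_d -> S -> R)
  (fm : 'rV[R]_d -> 'rV[R]_d -> S -> R) (tau L : R)
  (K : nat) (m : nat -> nat) (theta gamma : nat -> R)
  (xi : nat -> nat -> {RV P >-> S}) (x0 : 'rV[R]_d)
  (x y z : nat -> Omega -> 'rV[R]_d).
Local Notation V := 'rV[R]_d.
Local Notation f := (objective Xi F).
Local Notation measurableV f := (measurable_fun setT (f : _ -> borel_rV R d)).

Hypothesis clX : closed X.
Hypothesis cX : convex_set (X : set (convex_lmodType _)).
Hypothesis FX : stochastic_objective Xi X F.
Hypothesis L_gt0 : 0 < L.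
Hypothesis model : model_family X F fm tau L.
Hypothesis theta_gt0 : forall k, 0 < theta k.
Hypothesis theta_le1 : forall k, theta k <= 1.
Hypothesis gamma_gt0 : forall k, 0 < gamma k.
Hypothesis m_gt0 : forall k, (0 < m k)%N.
Hypothesis iid : iid_batches Xi K m xi.
Hypothesis Xx0 : X x0.
Hypothesis method : accelerated_model_method X fm K m theta gamma xi x0 x0 x y z.

Let theta01 k : 0 <= theta k <= 1.
Proof. by rewrite theta_le1 ltW. Qed.

Let F_integrable u : X u -> Xi.-integrable setT (EFin \o F u).
Proof. by move=> Xu; case: FX => _ h _; exact: h. Qed.

Lemma objectiveE u : f u = \int[Xi]_s F u s.
Proof. by rewrite /objective unlock. Qed.

Lemma objective_lipschitz u v : X u -> X v -> f u - f v <= L * enorm (u - v).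
Proof.
move=> Xu Xv; rewrite !objectiveE.
have := le_Rintegral_affine (F_integrable Xu) (F_integrable Xv) (F_integrable Xv)
  (a := 1) (b := 0) (c := L * enorm (u - v)).
suff h : forall s, F u s <= 1 * F v s + 0 * F v s + L * enorm (u - v).
  by move=> /(_ h); lra.
by move=> s; have := sample_lipschitz model s Xu Xv; lra.
Qed.

Lemma iterates_in k w : (k <= K.+1)%N -> X (x k w) /\ X (z k w).
Proof.
case: method => start step.
elim: k => [|k IH] kK; first by have [-> ->] := start w.
have [yE [Xz _] ->] := step k w kK.
by split=> //; apply: convex_setP => //; case: (IH (ltnW kK)).
Qed.

Let X_x k w : (k <= K.+1)%N -> X (x k w).
Proof. by move=> /(iterates_in w)[]. Qed.

Let X_z k w : (k <= K.+1)%N -> X (z k w).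
Proof. by move=> /(iterates_in w)[]. Qed.

Lemma extrapolation_in k w : (k <= K)%N -> X (y k w).
Proof.
move=> kK; case: method => _ /(_ k w kK)[-> _ _].
by apply: convex_setP => //; [apply: X_x|apply: X_z]; exact: leqW.
Qed.
Let X_y := extrapolation_in.

(** Step [j] moves [z] by at most [L / gamma j], so this bounds the sup-norm distance to [x0] for
    every outcome. *)
Definition iterate_radius k : R := \sum_(j < k) L / gamma j.

Lemma iterate_radiusS k : iterate_radius k.+1 = iterate_radius k + L / gamma k.
Proof. by rewrite /iterate_radius big_ord_recr. Qed.

Lemma iterate_radius_leS k : iterate_radius k <= iterate_radius k.+1.
Proof. by rewrite iterate_radiusS lerDl divr_ge0// ltW. Qed.

Lemma norm_conv_le (a b c : V) (t r : R) : 0 <= t <= 1 ->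
  `|a - c| <= r -> `|b - c| <= r -> `|(1 - t) *: a + t *: b - c| <= r.
Proof.
move=> /andP[t0 t1] ar br.
rewrite [X in `|X|](_ : _ = (1 - t) *: (a - c) + t *: (b - c)); last first.
  by rewrite !scalerBr addrACA -opprD -scalerDl subrK scale1r.
rewrite (le_trans (ler_normD _ _))// !normrZ (ger0_norm t0) ger0_norm ?subr_ge0//.
nra.
Qed.

(** The batch [b] is arbitrary because the bound serves the actual step and also the step with a
    resampled batch. *)
Lemma prox_radius k w (b : nat -> S) v : (k <= K)%N ->
  `|z k w - x0| <= iterate_radius k ->
  argmin X (prox_objective (batch_model fm (m k) b (y k w)) (gamma k) (z k w)) v ->
  `|v - x0| <= iterate_radius k.+1.
Proof.
move=> kK zr vmin; rewrite iterate_radiusS -(subrKA (z k w)).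
rewrite (le_trans (ler_normD _ _))// addrC lerD//.
rewrite (le_trans (ler_norm_enorm _))//.
apply: (prox_step cX (gamma_gt0 k) L_gt0 _ _ _ vmin).
- by apply: (batch_model_convex model); exact: X_y.
- by move=> *; apply: (batch_model_lipschitz model) => //; exact: X_y.
- by apply: X_z; exact: leqW.
Qed.

Lemma iterates_radius k w : (k <= K.+1)%N ->
  `|x k w - x0| <= iterate_radius k /\ `|z k w - x0| <= iterate_radius k.
Proof.
case: (method) => start step.
elim: k => [|k IH] kK.
  by have [-> ->] := start w; rewrite subrr normr0 /iterate_radius big_ord0.
have [xr zr] := IH (ltnW kK).
have [_ zmin ->] := step k w kK.
have zr' := prox_radius kK zr zmin; split=> //.
by apply: norm_conv_le => //; exact: le_trans (iterate_radius_leS k).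
Qed.

Lemma extrapolation_radius k w : (k <= K)%N ->
  `|y k w - x0| <= iterate_radius k.
Proof.
move=> kK; have [xr zr] := iterates_radius w (leqW kK).
by case: method => _ /(_ k w kK)[-> _ _]; exact: norm_conv_le.
Qed.

(* [T] is [Omega] itself, or [Omega] with a smaller sigma-algebra times the
   space of a fresh sample. *)
Lemma measurable_iterates {dT : measure_display} {T : measurableType dT}
    (W : T -> Omega) k : (k <= K.+1)%N ->
  (forall j i, (j < k)%N -> (i < m j)%N -> measurable_fun setT (xi j i \o W)) ->
  measurableV (x k \o W) /\ measurableV (z k \o W).
Proof.
case: (method) => start step.
elim: k => [|k IH] kK mxi.
  rewrite (_ : x 0%N \o W = cst x0); last by apply/funext => t; exact: (start _).1.
  rewrite (_ : z 0%N \o W = cst x0); last by apply/funext => t; exact: (start _).2.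
  by split; exact: measurable_cst.
have [|mx mz] := IH (ltnW kK).
  by move=> j i jk im; apply: mxi => //; exact: ltnW.
have my : measurableV (y k \o W).
  rewrite (_ : y k \o W = fun t => (1 - theta k) *: x k (W t) + theta k *: z k (W t)).
    exact: measurable_scaleDscale.
  by apply/funext => t; have [] := step k (W t) kK.
have mz' : measurableV (z k.+1 \o W).
  apply: (measurable_prox clX cX L_gt0 model (n := m k) (g := gamma k)
     (b := fun i => xi k i \o W) (f := y k \o W) (z := z k \o W)) => //.
  - by move=> i im; exact: mxi.
  - by move=> t; exact: X_y.
  - by move=> t; apply: X_z; exact: leqW.
  - by move=> t; have [] := step k (W t) kK.
split=> //.
rewrite (_ : x k.+1 \o W = fun t => (1 - theta k) *: x k (W t) + theta k *: z k.+1 (W t)).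
  exact: measurable_scaleDscale.
by apply/funext => t; have [] := step k (W t) kK.
Qed.

Lemma measurable_extrapolation {dT : measure_display} {T : measurableType dT}
    (W : T -> Omega) k : (k <= K)%N ->
  (forall j i, (j < k)%N -> (i < m j)%N -> measurable_fun setT (xi j i \o W)) ->
  measurableV (y k \o W).
Proof.
move=> kK mxi; have [mx mz] := measurable_iterates (leqW kK) mxi.
rewrite (_ : y k \o W = fun t => (1 - theta k) *: x k (W t) + theta k *: z k (W t)).
  exact: measurable_scaleDscale.
by apply/funext => t; case: method => _ /(_ k (W t) kK)[].
Qed.

Lemma objective_iterate_integrable k : (k <= K.+1)%N ->
  P.-integrable setT (EFin \o (fun w => f (x k w))).
Proof.
move=> kK.
have cf := lipschitz_within_continuous L_gt0 objective_lipschitz.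
have [mx _] := @measurable_iterates _ Omega id k kK (fun _ _ _ _ => ltac:(by [])).
have mfx : measurable_fun setT (fun w => f (x k w)).
  by apply: (within_continuous_measurable cf _ mx) => w; exact: X_x.
apply: (dominated_integrable (c := L * (Num.sqrt d%:R * iterate_radius k)) mfx
  (probability_integrable_cst P (f x0))) => w /=.
have Xx := X_x w kK; have [xr _] := iterates_radius w kK.
have h1 := objective_lipschitz Xx Xx0; have h2 := objective_lipschitz Xx0 Xx.
rewrite enormBC in h2.
have h3 : L * enorm (x k w - x0) <= L * (Num.sqrt d%:R * iterate_radius k).
  rewrite ler_wpM2l ?(ltW L_gt0)// (le_trans (ler_enorm_norm _))//.
  by rewrite ler_wpM2l ?sqrtr_ge0.
have := ler_norm (f x0); have := ler_norm (- f x0); rewrite normrN => *.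
rewrite ler_norml; apply/andP; split; lra.
Qed.

(** * Resampling and the one-step descent inequality *)

Lemma sample_integral k i (g : S -> R) : (k <= K)%N -> (i < m k)%N ->
  Xi.-integrable setT (EFin \o g) ->
  P.-integrable setT (EFin \o (fun w => g (xi k i w))) /\
  \int[P]_w g (xi k i w) = \int[Xi]_s g s.
Proof.
move=> kK im ig.
have law A : measurable A -> distribution P (xi k i) A = Xi A.
  by case: iid => h _; exact: h.
have mg : measurable_fun setT (EFin \o g) by case/integrableP : ig.
have igp : (pushforward P (xi k i)).-integrable setT (EFin \o g).
  apply/integrableP; split=> //; rewrite (eq_measure_integral Xi).
    by case/integrableP : ig.
  by move=> A mA _; exact: law.
have igP : P.-integrable setT ((EFin \o g) \o xi k i).
  exact: integrable_comp_pushforward.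
split=> //; rewrite /Rintegral; congr fine.
rewrite -(@integral_pushforward _ _ _ _ _ (xi k i) _ P setT (EFin \o g))//.
by apply: eq_measure_integral => A mA _; exact: law.
Qed.

(* One sample of the batch is replaced by a fresh one: by stability of the
   proximal step this costs at most [2 L^2 / (m gamma)], and by independence the
   fresh sample may be integrated out first. *)
Lemma resampling k (i : 'I_(m k)) : (k <= K)%N -> exists Psi : Omega -> R,
  [/\ P.-integrable setT (EFin \o Psi),
      P.-integrable setT (EFin \o (fun w => fm (y k w) (z k.+1 w) (xi k i w))),
      \int[P]_w Psi w = \int[P]_w fm (y k w) (z k.+1 w) (xi k i w) &
      forall w, f (x k.+1 w) <= (1 - theta k) * f (x k w)
        + theta k * (Psi w + 2 * L ^+ 2 / ((m k)%:R * gamma k))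
        + tau / 2 * (theta k ^+ 2 * enorm (z k.+1 w - z k w) ^+ 2)].
Proof.
move=> kK.
pose D := [set p : nat * nat | (p.1 <= K)%N /\ (p.2 < m p.1)%N].
pose Y (p : nat * nat) : {mfun Omega >-> S} := xi p.1 p.2.
pose p0 : nat * nat := (k, i : nat).
have Dp0 : D p0 by split=> //=; exact: ltn_ord.
have indep : mutually_independent P D Y by case: iid.
(* [T] is [Omega] with the sigma-algebra of all samples except sample [i] of batch [k]; conditioning
   on those samples is the identity map [W] into [T]. *)
pose G := other_cylinders D Y p0.
pose T := g_sigma_algebraType G.
have mW : measurable_fun setT (id : Omega -> T).
  move=> _ A mA; rewrite setTI preimage_id.
  have : <<s G >> `<=` @measurable _ Omega; last exact.
  apply: smallest_sub; first exact: sigma_algebra_measurable.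
  exact: other_cylinders_measurable.
pose W : {mfun Omega >-> T} :=
  HB.pack (id : Omega -> T) (isMeasurableFun.Build _ _ _ _ (id : Omega -> T) mW).
have mxi j i' : (j <= K)%N -> (i' < m j)%N -> (j, i') != p0 ->
    measurable_fun setT (xi j i' \o (fst : T * S -> Omega)).
  move=> jK i'm ji'.
  have mj : measurable_fun setT (Y (j, i') : T -> S) by apply: measurable_other.
  exact: (measurableT_comp mj measurable_fst).
(* Earlier batches do not contain the replaced sample, so the state before step [k] is measurable on
   [T]. *)
have mxi_past j i' : (j < k)%N -> (i' < m j)%N ->
    measurable_fun setT (xi j i' \o (fst : T * S -> Omega)).
  move=> jk i'm; apply: mxi => //; first exact: leq_trans (ltnW jk) kK.
  by apply/eqP => -[jE _]; rewrite jE ltnn in jk.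
have my := measurable_extrapolation kK mxi_past.
have [_ mz] := measurable_iterates (leqW kK) mxi_past.
(* Batch [k] with its [i]-th sample replaced by the fresh one. *)
pose b j (p : T * S) := if j == i :> nat then p.2 else xi k j p.1.
have mb j : (j < m k)%N -> measurable_fun setT (b j).
  move=> jm; rewrite /b; have [_|ji] := eqVneq j (i : nat).
    exact: measurable_snd.
  by apply: mxi => //; apply: contra ji => /eqP[->].
(* Any selection of minimizers will do, since [measurable_prox] applies to all of them. *)
have /choice[Z Zmin] (p : T * S) : exists v, argmin X (prox_objective
    (batch_model fm (m k) (b ^~ p) (y k p.1)) (gamma k) (z k p.1)) v.
  apply: (prox_exists (gamma_gt0 k) L_gt0 clX); last by apply: X_z; exact: leqW.
  by move=> u v Xu Xv; apply: (batch_model_lipschitz model) => //; exact: X_y.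
have mZ : measurableV Z.
  apply: (measurable_prox clX cX L_gt0 model (m_gt0 k) (gamma_gt0 k) mb my mz) => //.
  - by move=> t; exact: X_y.
  - by move=> t; apply: X_z; exact: leqW.
pose psi (p : T * S) := fm (y k p.1) (Z p) p.2.
have mpsi : measurable_fun setT psi.
  apply: (measurable_model clX model my mZ) => //.
  - by move=> t; exact: X_y.
  - by move=> t; case: (Zmin t).
have zmin w := let: And3 _ h _ := method.2 k w kK in h.
have bxi w : b ^~ (w, xi k i w) = fun j => xi k j w.
  by apply/funext => j; rewrite /b /=; case: eqP => // ->.
(* Inserting the actual sample restores the actual batch, and uniqueness identifies the
   minimizer. *)
have Zz w : Z (w, xi k i w) = z k.+1 w.
  have := Zmin (w, xi k i w); rewrite bxi /= => h.
  apply: (prox_unique cX (gamma_gt0 k) _ (zmin w) h).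
  by apply: (batch_model_convex model); exact: X_y.
pose C := L * (Num.sqrt d%:R * (3 * iterate_radius k.+1)).
have psi_le p : `|psi p| <= `|F x0 p.2| + C.
  apply: (model_dist_bound L_gt0 model) => //.
  - exact: X_y.
  - by case: (Zmin p).
  - exact: le_trans (extrapolation_radius p.1 kK) (iterate_radius_leS k).
  - apply: (prox_radius kK _ (Zmin p)).
    by have [] := iterates_radius p.1 (leqW kK).
have F0 := F_integrable Xx0.
have psi_section t : Xi.-integrable setT (EFin \o (fun s => psi (t, s))).
  apply: (dominated_integrable (c := C) _ F0) => [|s]; last exact: (psi_le (t, s)).
  exact: measurable_fun_pair2.
have [F0xi _] := sample_integral kK (ltn_ord i) F0.
have psi_int : P.-integrable setT (EFin \o (fun w => psi (W w, xi k i w))).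
  apply: (dominated_integrable (c := C) _ F0xi) => [|w].
    by apply: (measurableT_comp mpsi); exact: measurable_fun_pair.
  exact: (psi_le (w, xi k i w)).
have WY A B : measurable A -> measurable B ->
    P (W @^-1` A `&` xi k i @^-1` B) = (P (W @^-1` A) * Xi B)%E.
  move=> mA mB; have := independent_other Dp0 indep mA mB.
  rewrite -(iid.1 k i kK (ltn_ord i) B mB); exact.
have [PsiI PsiE] := independent_fubini WY mpsi psi_int psi_section.
have psiE : (fun w => psi (W w, xi k i w)) =
    (fun w => fm (y k w) (z k.+1 w) (xi k i w)).
  by apply/funext => w; rewrite /psi /= Zz.
rewrite psiE in psi_int PsiE.
exists (fun w => \int[Xi]_s psi (w, s)); split=> // w.
have [yE [Xz _] xE] := method.2 k w kK.
have Xx := X_x w (leqW kK); have Xx' := X_x w (kK : (k.+1 <= K.+1)%N).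
have Xy := X_y w kK.
set e := enorm (z k.+1 w - z k w) ^+ 2.
set c := 2 * L ^+ 2 / _.
(* For a fixed fresh sample: pass from [F] to the model at [y k], split [x k.+1] by convexity, then
   replace [z k.+1] by the displaced minimizer at cost [c]. *)
have pointwise s : F (x k.+1 w) s <= (1 - theta k) * F (x k w) s
    + theta k * (psi (w, s) + c) + tau / 2 * (theta k ^+ 2 * e).
  have XZ : X (Z (w, s)) by case: (Zmin (w, s)).
  have h1 := model_ge model s Xy Xx'.
  have h2 : fm (y k w) (x k.+1 w) s <=
      (1 - theta k) * fm (y k w) (x k w) s + theta k * fm (y k w) (z k.+1 w) s.
    by rewrite xE; apply: (@convex_functionP _ _ X (fun v => fm (y k w) v s)) => //;
       case: model => + _ _ _ _; exact.
  have h3 := model_le model s Xy Xx.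
  have h4 := model_lipschitz model s Xy Xz XZ.
  have h5 : enorm (z k.+1 w - Z (w, s)) <= 2 * L / ((m k)%:R * gamma k).
    rewrite enormBC; apply: (batch_prox_stability cX L_gt0 model (m_gt0 k) (i := i)
      (gamma_gt0 k) Xy _ (zmin w) (Zmin (w, s))).
    by move=> j ji; rewrite /b (negbTE ji).
  have h6 : L * enorm (z k.+1 w - Z (w, s)) <= c.
    have -> : c = L * (2 * L / ((m k)%:R * gamma k)) by rewrite /c; ring.
    by rewrite ler_pM2l.
  (* The extrapolation gives [x k.+1 - y k = theta k *: (z k.+1 - z k)]. *)
  have h7 : enorm (y k w - x k.+1 w) ^+ 2 = theta k ^+ 2 * e.
    rewrite yE xE opprD addrACA subrr add0r -scalerBr sqr_enormZ.
    by rewrite enormBC.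
  rewrite h7 in h1.
  have t0 := theta01 k; case/andP : t0 => t0 t1.
  have h8 : (1 - theta k) * fm (y k w) (x k w) s <= (1 - theta k) * F (x k w) s.
    by rewrite ler_wpM2l// subr_ge0.
  have h9 : theta k * fm (y k w) (z k.+1 w) s <= theta k * (psi (w, s) + c).
    rewrite ler_wpM2l// /psi /=; lra.
  lra.
have := le_Rintegral_affine (F_integrable Xx') (F_integrable Xx) (psi_section w)
  (a := 1 - theta k) (b := theta k)
  (c := theta k * c + tau / 2 * (theta k ^+ 2 * e)).
rewrite -!objectiveE => h.
suff /h : forall s, F (x k.+1 w) s <= (1 - theta k) * F (x k w) s
    + theta k * psi (w, s) + (theta k * c + tau / 2 * (theta k ^+ 2 * e)) by lra.
by move=> s; have := pointwise s; lra.
Qed.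

(** The resampling bounds are averaged over the batch, and the three-point inequality compares the
    batch model at [z k.+1] with that at [u]. Mean-zero discrepancies go into [N]; the curvature
    error is absorbed by the proximal term because [tau * theta k <= gamma k]. *)
Lemma noisy_descent k u : (k <= K)%N -> tau * theta k <= gamma k -> X u ->
  exists N : Omega -> R, centered P N /\ forall w,
    f (x k.+1 w) - f u + theta k * gamma k / 2 * enorm (u - z k.+1 w) ^+ 2
    <= (1 - theta k) * (f (x k w) - f u)
       + theta k * gamma k / 2 * enorm (u - z k w) ^+ 2
       + 2 * L ^+ 2 * theta k / ((m k)%:R * gamma k) + theta k * N w.
Proof.
move=> kK tg Xu.
have /choice[Psi PsiP] := fun i : 'I_(m k) => resampling i kK.
pose M i w := fm (y k w) (z k.+1 w) (xi k i w).
(* Two centered parts: the resampled mean against the actual model term, and the sampled value at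
   [u] against [f u]. The explicit coefficients fit [centered_lincomb]. *)
pose N0 (i : 'I_(m k)) w := 1 * (1 * Psi i w + (-1) * M i w)
  + 1 * (1 * F u (xi k i w) + (-1) * cst (f u) w).
have cN0 i : centered P (N0 i).
  have [iPsi iM PsiM _] := PsiP i.
  have [iF FE] := sample_integral kK (ltn_ord i) (F_integrable Xu).
  have ic := probability_integrable_cst P (f u).
  apply: centered_lincomb; split; try exact: integrable_lincomb.
    by rewrite Rintegral_lincomb// PsiM mul1r mulN1r subrr.
  rewrite Rintegral_lincomb// FE Rintegral_probability_cst objectiveE.
  by rewrite mul1r mulN1r subrr.
exists (fun w => \sum_(i < m k) (m k)%:R^-1 * N0 i w); split.
  exact: (centered_sum (fun=> _)).
move=> w; rewrite -mulr_sumr.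
have m0 : (0 : R) < (m k)%:R by rewrite ltr0n.
have Xy := X_y w kK; have [_ zmin _] := method.2 k w kK.
have /andP[t0 t1] := theta01 k.
set e := enorm (z k.+1 w - z k w) ^+ 2.
have e0 : 0 <= e by exact: sqr_ge0.
pose avg (g : 'I_(m k) -> R) := (m k)%:R^-1 * \sum_(i < m k) g i.
have avg_affine a b g : avg (fun i => a + b * g i) = a + b * avg g.
  rewrite /avg big_split/= sumr_const card_ord -mulr_sumr mulrDr -[a *+ _]mulr_natl.
  by rewrite mulKf ?lt0r_neq0// mulrCA.
have avgE : (m k)%:R^-1 * \sum_(i < m k) N0 i w =
    avg (Psi ^~ w) - avg (M ^~ w) + avg (fun i => F u (xi k i w)) - f u.
  rewrite (_ : f u = avg (fun i => f u + 0 * Psi i w)); last first.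
    by rewrite avg_affine mul0r addr0.
  rewrite /avg.
  rewrite !mulr_sumr -sumrB -big_split/= -sumrB; apply: eq_bigr => i _.
  by rewrite /N0 /cst; ring.
set c := 2 * L ^+ 2 / ((m k)%:R * gamma k).
have h1 : f (x k.+1 w) <= (1 - theta k) * f (x k w)
    + theta k * (avg (Psi ^~ w) + c) + tau / 2 * (theta k ^+ 2 * e).
  pose A := (1 - theta k) * f (x k w) + theta k * c + tau / 2 * (theta k ^+ 2 * e).
  have : f (x k.+1 w) + 0 * avg (Psi ^~ w) <= A + theta k * avg (Psi ^~ w).
    rewrite -!avg_affine ler_wpM2l ?invr_ge0 ?ler0n// ler_sum// => i _.
    by have [_ _ _ /(_ w)] := PsiP i; rewrite -/c -/e /A; lra.
  by rewrite /A; lra.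
have h2 : avg (M ^~ w) + gamma k / 2 * e + gamma k / 2 * enorm (u - z k.+1 w) ^+ 2
    <= avg (fun i => F u (xi k i w)) + gamma k / 2 * enorm (u - z k w) ^+ 2.
  have h3 := prox_three_point cX (batch_model_convex model (m k) (fun i => xi k i w) Xy) zmin Xu.
  apply: (le_trans h3); rewrite /prox_objective.
  rewrite lerD2r ler_wpM2l ?invr_ge0 ?ler0n// ler_sum// => i _.
  exact: (model_le model).
rewrite avgE.
have := ler_wpM2l t0 h2.
(* Half of this quantity is the surplus of the proximal term over the curvature error. *)
have : 0 <= (gamma k - tau * theta k) * (theta k * e).
  by rewrite mulr_ge0 ?subr_ge0// mulr_ge0.
have -> : 2 * L ^+ 2 * theta k / ((m k)%:R * gamma k) = theta k * c.
  by rewrite /c; ring.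
move: (avg _) (avg _) (avg _) h1 => a1 a2 a3 h1.
move: c h1 => c h1; move: e e0 h1 h2 => e e0 h1 h2.
lra.
Qed.

Lemma accelerated_rate u : X u -> (forall k, (0 < k)%N -> theta k < 1) ->
  (forall k, Gamma theta k.+1 * gamma k.+1 * theta k.+1
      <= Gamma theta k * gamma k * theta k /\ tau * theta k <= gamma k) ->
  ((Gamma theta K)%:E * 'E_P[fun w => (f (x K.+1 w) - f u)%R]
  <= ((1 - theta 0%N) * (f x0 - f u)
      + Gamma theta 0 * gamma 0%N * theta 0%N / 2 * enorm (u - x0) ^+ 2
      + \sum_(k < K.+1)
          2 * L ^+ 2 * Gamma theta k * theta k / ((m k)%:R * gamma k))%:E)%E.
Proof.
move=> Xu theta_lt1 cond.
(* Nothing is claimed beyond step [K]; [cst 0] merely makes the choice total. *)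
have /choice[N NP] : forall k, exists N : Omega -> R, (k <= K)%N ->
    centered P N /\ forall w,
    f (x k.+1 w) - f u + theta k * gamma k / 2 * enorm (u - z k.+1 w) ^+ 2
    <= (1 - theta k) * (f (x k w) - f u)
       + theta k * gamma k / 2 * enorm (u - z k w) ^+ 2
       + 2 * L ^+ 2 * theta k / ((m k)%:R * gamma k) + theta k * N w.
  move=> k; have [kK|kK] := leqP k K; last by exists (cst 0).
  by have [N NP] := noisy_descent kK (cond k).2 Xu; exists N.
apply: (@expectation_le_centered _ _ _ P _
  (fun w => \sum_(k < K.+1) (Gamma theta k * theta k) * N k w)).
- exact: Gamma_gt0.
- have := integrable_lincomb 1 (-1) (objective_iterate_integrable (leqnn K.+1))
    (probability_integrable_cst P (f u)).
  by under eq_fun do rewrite mul1r mulN1r.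
- by apply: centered_sum => k; have [] := NP k (ltn_ord k : (k <= K)%N).
move=> w; have [start _] := method; have [xw zw] := start w.
apply: (le_trans (@weighted_telescope _ theta theta_lt1 gamma
  (fun k => f (x k w) - f u) (fun k => enorm (u - z k w) ^+ 2)
  (fun k => 2 * L ^+ 2 * theta k / ((m k)%:R * gamma k))
  (fun k => theta k * N k w) K _ _ _ _)).
- by move=> k; exact: sqr_ge0.
- by move=> k _; case: (cond k).
- rewrite !mulr_ge0 ?(ltW (Gamma_gt0 theta_lt1 _))// ltW//.
- by move=> k kK; have [_] := NP k kK; apply.
rewrite xw zw le_eqVlt; apply/orP; left; apply/eqP; congr (_ + _ + _); apply: eq_bigr => k _; ring.
Qed.

End Method.

Theorem theoremC5 (R : realType) (d : nat)
  (dO dS : measure_display) (Omega : measurableType dO) (P : probability Omega R)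
  (S : measurableType dS) (Xi : probability S R)
  (X : set 'rV[R]_d) (F : 'rV[R]_d -> S -> R)
  (fm : 'rV[R]_d -> 'rV[R]_d -> S -> R) (tau L : R)
  (K : nat) (m : nat -> nat) (theta gamma : nat -> R)
  (xi : nat -> nat -> {RV P >-> S})
  (x0 z0 : 'rV[R]_d) (x y z : nat -> Omega -> 'rV[R]_d) (u : 'rV[R]_d) :
  X !=set0 -> closed X -> convex_set (X : set (convex_lmodType _)) ->
  stochastic_objective Xi X F ->
  0 <= tau -> 0 < L ->
  model_family X F fm tau L ->
  0 < theta 0%N <= 1 ->
  (forall k, (1 <= k)%N -> 0 < theta k < 1) ->
  (forall k, 0 < gamma k) ->
  (forall k, (1 <= m k)%N) ->
  iid_batches Xi K m xi ->
  X x0 -> x0 = z0 ->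
  accelerated_model_method X fm K m theta gamma xi x0 z0 x y z ->
  X u ->
  ((forall k,
      Gamma theta k.+1 * gamma k.+1 * theta k.+1
        <= Gamma theta k * gamma k * theta k /\
      tau * theta k <= gamma k) ->
   ((Gamma theta K)%:E *
      'E_P[fun w => (objective Xi F (x K.+1 w) - objective Xi F u)%R]
    <= ((1 - theta 0%N) * (objective Xi F x0 - objective Xi F u)
        + Gamma theta 0 * gamma 0%N * theta 0%N / 2 * enorm (u - z0) ^+ 2
        + \sum_(k < K.+1)
            2 * L ^+ 2 * Gamma theta k * theta k / ((m k)%:R * gamma k))%:E)%E)
  /\
  (forall (mb : nat) (D : R),
     argmin X (objective Xi F) u ->
     0 < D -> enorm (x0 - u) <= D ->
     (forall k, m k = mb) ->
     (forall k, theta k = 2 / (k + 2)%:R) ->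
     (let eta := 2 * L / (Num.sqrt (3 * mb%:R) * D) * (K + 2)%:R `^ (3 / 2) in
      forall k, gamma k = (2 * tau + eta) / (k + 1)%:R) ->
     ('E_P[fun w => (objective Xi F (x K.+1 w) - objective Xi F u)%R]
      <= (2 * tau * D ^+ 2 / ((K + 1)%:R * (K + 2)%:R)
          + 4 * Num.sqrt 2 * L * D
              / Num.sqrt (3 * mb%:R * (K + 1)%:R))%:E)%E).
Proof.
move=> _ clX cX FX tau0 L0 model theta0 thetaS gamma0 m0 iid Xx0 <- method Xu.
have theta_gt0 k : 0 < theta k.
  by case: k => [|k]; [case/andP: theta0|case/andP: (thetaS k.+1 isT)].
have theta_lt1 k : (0 < k)%N -> theta k < 1 by move=> /thetaS/andP[].
have theta_le1 k : theta k <= 1.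
  by case: k => [|k]; [case/andP: theta0|exact/ltW/theta_lt1].
have rate := accelerated_rate clX cX FX L0 model theta_gt0 theta_le1 gamma0 m0
  iid Xx0 method Xu theta_lt1.
split=> // mb D _ D0 xuD mE thetaE.
set eta := 2 * L / _ * _ => gammaE.
have mb0 : (0 : R) < mb%:R by rewrite ltr0n -(mE 0%N).
have GE := GammaE thetaE.
have k1 k : (0 : R) < (k + 1)%:R by rewrite ltr0n addn1.
have k2 k : (0 : R) < (k + 2)%:R by rewrite ltr0n addn2.
have g_gt0 : 0 < 2 * tau + eta.
  by have := gamma0 0%N; rewrite gammaE add0n divr1.
(* The weights are constant in [k], so the monotonicity condition holds with equality. *)
have GgtE k : Gamma theta k * gamma k * theta k = 2 * tau + eta.
  by rewrite GE gammaE thetaE; field; rewrite !gt_eqF.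
have cond k : Gamma theta k.+1 * gamma k.+1 * theta k.+1
    <= Gamma theta k * gamma k * theta k /\ tau * theta k <= gamma k.
  split; first by rewrite !GgtE.
  rewrite thetaE gammaE ler_pdivlMr// mulrA mulrAC ler_pdivrMr//.
  have eta0 : 0 <= eta.
    rewrite mulr_ge0 ?powR_ge0// divr_ge0 ?mulr_ge0 ?sqrtr_ge0// ltW//.
  have : (k + 1)%:R <= (k + 2)%:R :> R by rewrite ler_nat leq_add2l.
  have := mulr_ge0 eta0 (ltW (k2 k)).
  move=> e2 /(ler_wpM2l tau0); move: e2; move: (k + 1)%:R (k + 2)%:R => a b; lra.
have {cond}rate := rate cond.
have G0 : 0 < Gamma theta K by exact: Gamma_gt0.
rewrite -(@lee_pmul2l _ (Gamma theta K)%:E)//; apply: (le_trans rate).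
rewrite -EFinM lee_fin.
have bound := balanced_step_bound tau0 L0 D0 mb0 (erefl (K + 2)%:R) (erefl eta).
rewrite -GE in bound; apply: le_trans bound.
(* Since [theta 0 = 1], the initial gap vanishes and only the distance term and the error sum
   remain. *)
rewrite GgtE (thetaE 0%N) add0n divff// subrr mul0r add0r; apply: lerD.
  rewrite ler_wpM2l ?divr_ge0 ?(ltW g_gt0)// enormBC.
  by rewrite lerXn2r ?nnegrE ?enorm_ge0 ?(ltW D0).
(* Each summand equals [2 L^2 / (mb (2 tau + eta))] times [(k + 1)^2], so the sum of squares bounds
   the total. *)
apply: le_trans; last apply: (ler_wpM2l _ (sum_sqr_le K)); last first.
  by rewrite divr_ge0 ?mulr_ge0 ?sqr_ge0 ?ltW// ltW.
rewrite mulr_sumr; apply: ler_sum => k _.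
rewrite GE thetaE gammaE mE le_eqVlt; apply/orP; left; apply/eqP.
by field; rewrite !gt_eqF.
Qed.
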